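(* Let $\Delta$ be a nonempty finite graph with no universal vertex (so $|V(\Delta)|\geq2$), and let $\Gamma=\Delta*K_2$ be the join of $\Delta$ with the complete graph on two vertices. Then $$\mathrm{Aut}(H_\Gamma)\cong\mathbb Z^{V(\Delta)}\rtimes\big(\mathrm{Aut}(A_\Delta)\times\mathbb Z/2\mathbb Z\big),\qquad \mathrm{Out}(H_\Gamma)\cong\mathbb Z^{V(\Delta)}\rtimes\big(\mathrm{Out}(A_\Delta)\times\mathbb Z/2\mathbb Z\big),$$ and the embeddings $\mathrm{Aut}(A_\Delta)\hookrightarrow\mathrm{Aut}(H_\Gamma)$ and $\mathrm{Out}(A_\Delta)\hookrightarrow\mathrm{Out}(H_\Gamma)$ given by extending by the identity are the inclusions of the $\mathrm{Aut}(A_\Delta)$- and $\mathrm{Out}(A_\Delta)$-factors of the semidirect complements. In particular both embeddings are retracts: there are surjective homomorphisms $\mathrm{Aut}(H_\Gamma)\to\mathrm{Aut}(A_\Delta)$ and $\mathrm{Out}(H_\Gamma)\to\mathrm{Out}(A_\Delta)$ restricting to the identity on the embedded copies. Every automorphism group of a centerless right-angled Artin group is therefore a retract of the automorphism group of a Bestvina--Brady group of type $F$ with biconnected defining graph.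
   Context: All graphs are finite and simple. For a graph $\Gamma$, $A_\Gamma=\langle V(\Gamma)\mid [u,v]=1 \text{ whenever } uv\in E(\Gamma)\rangle$ is the right-angled Artin group, $\chi_\Gamma:A_\Gamma\to\mathbb Z$ is the character with $\chi_\Gamma(v)=1$ for every vertex $v$, and the Bestvina--Brady group is $H_\Gamma=\ker\chi_\Gamma$. The join $\Gamma_1*\Gamma_2$ is the disjoint union with all edges between $V(\Gamma_1)$ and $V(\Gamma_2)$ added. A vertex is universal if it is adjacent to every other vertex (a single vertex is universal in its own graph). A connected graph with at least three vertices is biconnected if deleting any one vertex leaves it connected. A group is of type $F$ if it has a finite classifying space. Writing $p,q$ for the vertices of $K_2$, there is an isomorphism $A_\Delta\times\mathbb Z\to H_\Gamma$, $(g,m)\mapsto g\,p^{m}q^{-\chi_\Delta(g)-m}$. Under it, the embedding $\mathrm{Aut}(A_\Delta)\hookrightarrow\mathrm{Aut}(H_\Gamma)$ sends $\alpha$ to $(g,m)\mapsto(\alpha(g),m)$, and it induces the embedding of outer automorphism groups. The normal factor $\mathbb Z^{V(\Delta)}$ is $\mathrm{Hom}(A_\Delta,\mathbb Z)$, $\mathbb Z/2\mathbb Z=\{\pm1\}$, and the actions in the semidirect products are $(\alpha,k)\cdot h=k\,(h\circ\alpha^{-1})$. *)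

(* Defs.v *)
From HB Require Import structures.
From mathcomp Require Import all_boot all_order all_algebra.
From mathcomp Require Import all_classical all_reals all_analysis.
Import Order.TTheory GRing.Theory Num.Theory.
Import numFieldNormedType.Exports.

Set Implicit Arguments.
Unset Strict Implicit.
Unset Printing Implicit Defensive.

Local Open Scope group_scope.
Local Open Scope quotient_scope.

(* The additive groups Z, Z/2 and Z^V, as groupTypes: here * is addition and
   1 is zero. *)
Notation Zg := (Algebra.to_multiplicative int).
Notation Z2g := (Algebra.to_multiplicative 'Z_2).
Notation ZgX V := {ffun V -> Zg}.

Definition centerless (G : groupType) : Prop :=
  forall z : G, (forall x, commute z x) -> z = 1.

Section Hom.
Variables (G K : groupType).

Lemma morph1 (f : G -> K) : {morph f : x y / x * y} -> f 1 = 1.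
Proof. by move=> fM; apply: (@mulgI _ (f 1)); rewrite -fM !mulg1. Qed.

Lemma morphV (f : G -> K) : {morph f : x y / x * y} -> {morph f : x / x^-1}.
Proof.
by move=> fM x; apply: (@mulgI _ (f x)); rewrite -fM !mulgV morph1.
Qed.

Lemma hom1 (f : {multiplicative G -> K}) : f 1 = 1.
Proof. exact/morph1/gmulfM. Qed.

Lemma homV (f : {multiplicative G -> K}) : {morph f : x / x^-1}.
Proof. exact/morphV/gmulfM. Qed.

End Hom.

Record giso (G H : groupType) := Giso {
  giso_fun :> G -> H;
  giso_inv : H -> G;
  gisoM : {morph giso_fun : x y / x * y};
  gisoK : cancel giso_fun giso_inv;
  gisoVK : cancel giso_inv giso_fun }.

Section GisoTheory.
Variables G H K : groupType.

Lemma gisoP (a b : giso G H) : a =1 b -> a = b.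
Proof.
case: a b => f f' fM fK f'K [g g' gM gK g'K] /= fg.
have {}fg : f = g by apply/funext.
subst g; have fg' : f' = g' by apply/funext => x; rewrite -{1}(g'K x) fK.
by subst g'; congr Giso; apply: Prop_irrelevance.
Qed.

Lemma giso_invM (a : giso G H) : {morph giso_inv a : x y / x * y}.
Proof.
by move=> x y; rewrite -{1}(gisoVK a x) -{1}(gisoVK a y) -gisoM gisoK.
Qed.

Definition giso_sym (a : giso G H) : giso H G :=
  Giso (@giso_invM a) (gisoVK a) (gisoK a).

Lemma giso_compM (a : giso H K) (b : giso G H) :
  {morph a \o b : x y / x * y}.
Proof. by move=> x y /=; rewrite !gisoM. Qed.

Lemma giso_compK (a : giso H K) (b : giso G H) :
  cancel (a \o b) (giso_inv b \o giso_inv a).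
Proof. by move=> x /=; rewrite !gisoK. Qed.

Lemma giso_compVK (a : giso H K) (b : giso G H) :
  cancel (giso_inv b \o giso_inv a) (a \o b).
Proof. by move=> x /=; rewrite !gisoVK. Qed.

Definition giso_comp (a : giso H K) (b : giso G H) : giso G K :=
  Giso (giso_compM a b) (giso_compK a b) (giso_compVK a b).

End GisoTheory.

Definition giso_id (G : groupType) : giso G G :=
  @Giso G G id id (fun _ _ => erefl) (fun _ => erefl) (fun _ => erefl).

(* The product of Aut G is composition: (a * b) x = a (b x). *)
Definition Aut (G : groupType) := giso G G.

Section AutGroup.
Variable G : groupType.
Implicit Types a b c : Aut G.

HB.instance Definition _ := gen_eqMixin (Aut G).
HB.instance Definition _ := gen_choiceMixin (Aut G).

Let autA : associative (@giso_comp G G G).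
Proof. by move=> a b c; apply: gisoP. Qed.
Let aut1l : left_id (giso_id G) (@giso_comp G G G).
Proof. by move=> a; apply: gisoP. Qed.
Let aut1r : right_id (giso_id G) (@giso_comp G G G).
Proof. by move=> a; apply: gisoP. Qed.
Let autVl : left_inverse (giso_id G) (@giso_sym G G) (@giso_comp G G G).
Proof. by move=> a; apply: gisoP => x /=; rewrite gisoK. Qed.
Let autVr : right_inverse (giso_id G) (@giso_sym G G) (@giso_comp G G G).
Proof. by move=> a; apply: gisoP => x /=; rewrite gisoVK. Qed.

HB.instance Definition _ := isGroup.Build (Aut G) autA aut1l aut1r autVl autVr.

Lemma autM_E a b x : (a * b) x = a (b x). Proof. by []. Qed.
Lemma aut1_E x : (1 : Aut G) x = x. Proof. by []. Qed.
Lemma autV_E a x : a^-1 x = giso_inv a x. Proof. by []. Qed.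

End AutGroup.

Section Inner.
Variable G : groupType.
Implicit Types a b c : Aut G.

Let innM (g : G) : {morph (fun x => g * x * g^-1) : x y / x * y}.
Proof. by move=> x y; rewrite !mulgA mulgVK. Qed.
Let innK (g : G) : cancel (fun x => g * x * g^-1) (fun x => g^-1 * x * g).
Proof. by move=> x; rewrite !mulgA mulgVK mulVg mul1g. Qed.
Let innVK (g : G) : cancel (fun x => g^-1 * x * g) (fun x => g * x * g^-1).
Proof. by move=> x; rewrite !mulgA mulgK mulgV mul1g. Qed.

Definition Inn (g : G) : Aut G := Giso (innM g) (innK g) (innVK g).

Lemma InnM g h : Inn (g * h) = Inn g * Inn h.
Proof. by apply: gisoP => x /=; rewrite invgM !mulgA. Qed.

Lemma Inn1 : Inn 1 = 1.
Proof. by apply: gisoP => x /=; rewrite invg1 mulg1 mul1g. Qed.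

Lemma InnJ a g : a * Inn g = Inn (a g) * a.
Proof.
apply: gisoP => x /=; rewrite !gisoM -!mulgA; congr (_ * (_ * _)).
apply: (@mulgI _ (a g)); rewrite mulgV -gisoM mulgV.
by apply: (@mulgI _ (a 1)); rewrite -gisoM !mulg1.
Qed.

Definition inner_eq a b : bool := `[< exists g, a = Inn g * b >].

Let inner_refl : reflexive inner_eq.
Proof. by move=> a; apply/asboolP; exists 1; rewrite Inn1 mul1g. Qed.
Let inner_sym : symmetric inner_eq.
Proof.
have sub a b : inner_eq a b -> inner_eq b a.
  move=> /asboolP[g ->]; apply/asboolP; exists g^-1.
  by rewrite mulgA -InnM mulVg Inn1 mul1g.
by move=> a b; apply/idP/idP; apply: sub.
Qed.
Let inner_trans : transitive inner_eq.
Proof.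
move=> b a c /asboolP[g ->] /asboolP[h ->]; apply/asboolP.
by exists (g * h); rewrite InnM mulgA.
Qed.

Canonical inner_equiv := EquivRel inner_eq inner_refl inner_sym inner_trans.

Definition Out := {eq_quot inner_equiv}.

HB.instance Definition _ := Choice.on Out.
HB.instance Definition _ := EqQuotient.on Out.

Definition out_of (a : Aut G) : Out := \pi a.

Lemma out_ofP a b : out_of a = out_of b <-> exists g, a = Inn g * b.
Proof. by split=> [/eqmodP/asboolP//|H]; apply/eqmodP/asboolP. Qed.

Definition out_mul (x y : Out) : Out := out_of (repr x * repr y).
Definition out_inv (x : Out) : Out := out_of (repr x)^-1.
Definition out_one : Out := out_of 1.

Lemma out_reprP a : exists g, repr (out_of a) = Inn g * a.
Proof. by apply/out_ofP; apply: (reprK (out_of a)). Qed.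

Lemma out_mulE a b : out_mul (out_of a) (out_of b) = out_of (a * b).
Proof.
rewrite /out_mul; have [g ->] := out_reprP a; have [h ->] := out_reprP b.
apply/out_ofP; exists (g * a h).
by rewrite InnM -!mulgA; congr (_ * _); rewrite !mulgA InnJ.
Qed.

Lemma out_invE a : out_inv (out_of a) = out_of a^-1.
Proof.
rewrite /out_inv; have [g ->] := out_reprP a.
apply/out_ofP; exists (a^-1 g^-1); rewrite -InnJ invgM; congr (_ * _).
by rewrite -[RHS]mul1g -(mulVg (Inn g)) -mulgA -InnM mulgV Inn1 mulg1.
Qed.

Let outA : associative out_mul.
Proof.
elim/quotW=> a; elim/quotW=> b; elim/quotW=> c.
by rewrite -!/(out_of _) !out_mulE mulgA.
Qed.
Let out1l : left_id out_one out_mul.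
Proof. by elim/quotW=> a; rewrite -/(out_of a) out_mulE mul1g. Qed.
Let out1r : right_id out_one out_mul.
Proof. by elim/quotW=> a; rewrite -/(out_of a) out_mulE mulg1. Qed.
Let outVl : left_inverse out_one out_inv out_mul.
Proof. by elim/quotW=> a; rewrite -/(out_of a) out_invE out_mulE mulVg. Qed.
Let outVr : right_inverse out_one out_inv out_mul.
Proof. by elim/quotW=> a; rewrite -/(out_of a) out_invE out_mulE mulgV. Qed.

HB.instance Definition _ := isGroup.Build Out outA out1l out1r outVl outVr.

Lemma out_ofM : {morph out_of : a b / a * b}.
Proof. by move=> a b; symmetry; apply: out_mulE. Qed.

HB.instance Definition _ := isMultiplicative.Build (Aut G) Out out_of out_ofM.

Lemma out_of1 : out_of 1 = 1. Proof. by []. Qed.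

Lemma out_of_surj (x : Out) : exists a, out_of a = x.
Proof. by exists (repr x); apply: reprK. Qed.

End Inner.

Record gaction (Q N : groupType) := Gaction {
  gact :> Q -> N -> N;
  gact1 : forall n, gact 1 n = n;
  gactA : forall q r n, gact (q * r) n = gact q (gact r n);
  gactM : forall q, {morph gact q : n m / n * m} }.

(* N ><| Q with product (n, q) (m, r) = (n (q . m), q r). *)
Definition semidirect (Q N : groupType) (a : gaction Q N) : Type := (N * Q)%type.

Section Semidirect.
Variables (Q N : groupType) (a : gaction Q N).

HB.instance Definition _ := Choice.copy (semidirect a) (N * Q)%type.

Definition sd_mul (x y : semidirect a) : semidirect a :=
  (x.1 * a x.2 y.1, x.2 * y.2).
Definition sd_one : semidirect a := (1, 1).
Definition sd_inv (x : semidirect a) : semidirect a :=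
  (a (x.2)^-1 (x.1)^-1, (x.2)^-1).

Let gact_1 q : a q 1 = 1.
Proof. by apply: (@mulgI _ (a q 1)); rewrite -gactM !mulg1. Qed.

Let sdA : associative sd_mul.
Proof.
by move=> [n q] [m r] [k s]; rewrite /sd_mul /= gactA gactM !mulgA.
Qed.
Let sd1l : left_id sd_one sd_mul.
Proof. by move=> [n q]; rewrite /sd_mul /= gact1 !mul1g. Qed.
Let sd1r : right_id sd_one sd_mul.
Proof. by move=> [n q]; rewrite /sd_mul /= gact_1 !mulg1. Qed.
Let sdVl : left_inverse sd_one sd_inv sd_mul.
Proof. by move=> [n q]; rewrite /sd_mul /= -gactM !mulVg gact_1. Qed.
Let sdVr : right_inverse sd_one sd_inv sd_mul.
Proof. by move=> [n q]; rewrite /sd_mul /= -gactA !mulgV gact1 mulgV. Qed.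

HB.instance Definition _ :=
  isGroup.Build (semidirect a) sdA sd1l sd1r sdVl sdVr.

Definition sd_inr (q : Q) : semidirect a := (1, q).

End Semidirect.

(* The letter (v, true) stands for v and (v, false) for its inverse. *)
Definition word (V : choiceType) := seq (V * bool).

Section Presented.
Variables (V : choiceType) (rels : word V -> Prop).

Inductive word_eq : word V -> word V -> Prop :=
| word_refl w : word_eq w w
| word_sym w1 w2 : word_eq w1 w2 -> word_eq w2 w1
| word_trans w2 w1 w3 : word_eq w1 w2 -> word_eq w2 w3 -> word_eq w1 w3
| word_cat w1 w2 u1 u2 :
    word_eq w1 w2 -> word_eq u1 u2 -> word_eq (w1 ++ u1) (w2 ++ u2)
| word_cancel v b : word_eq [:: (v, b); (v, ~~ b)] [::]
| word_rel r : rels r -> word_eq r [::].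

Let weq (w1 w2 : word V) : bool := `[< word_eq w1 w2 >].

Let weq_refl : reflexive weq.
Proof. by move=> w; apply/asboolP; apply: word_refl. Qed.
Let weq_sym : symmetric weq.
Proof. by move=> w1 w2; apply/asboolP/asboolP; apply: word_sym. Qed.
Let weq_trans : transitive weq.
Proof.
by move=> w2 w1 w3 /asboolP h1 /asboolP h2; apply/asboolP; apply: word_trans h2.
Qed.

Canonical word_equiv := EquivRel weq weq_refl weq_sym weq_trans.

Definition presented := {eq_quot word_equiv}.

HB.instance Definition _ := Choice.on presented.
HB.instance Definition _ := EqQuotient.on presented.

Definition pres_of (w : word V) : presented := \pi w.

Lemma presentedP w1 w2 : pres_of w1 = pres_of w2 <-> word_eq w1 w2.
Proof. by split=> [/eqmodP/asboolP//|H]; apply/eqmodP/asboolP. Qed.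

Definition word_inv (w : word V) : word V := rev [seq (l.1, ~~ l.2) | l <- w].

Lemma word_invK : involutive word_inv.
Proof.
move=> w; rewrite /word_inv map_rev revK -map_comp -[RHS]map_id.
by apply: eq_map => -[v b] /=; rewrite negbK.
Qed.

Lemma word_mulV w : word_eq (w ++ word_inv w) [::].
Proof.
elim: w => [|[v b] w IH]; first exact: word_refl.
have -> : ((v, b) :: w) ++ word_inv ((v, b) :: w)
    = [:: (v, b)] ++ ((w ++ word_inv w) ++ [:: (v, ~~ b)]).
  by rewrite /word_inv /= rev_cons -cats1 catA.
apply: (@word_trans ([:: (v, b)] ++ ([::] ++ [:: (v, ~~ b)]))).
  apply: word_cat; first exact: word_refl.
  by apply: word_cat => //; apply: word_refl.
exact: word_cancel.
Qed.

Lemma word_mulVl w : word_eq (word_inv w ++ w) [::].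
Proof. by rewrite -{2}(word_invK w); apply: word_mulV. Qed.

Lemma word_inv_eq w1 w2 : word_eq w1 w2 -> word_eq (word_inv w1) (word_inv w2).
Proof.
move=> h; apply: (@word_trans (word_inv w1 ++ (w2 ++ word_inv w2))).
  rewrite -{1}[word_inv w1]cats0; apply: word_cat; first exact: word_refl.
  by apply: word_sym; apply: word_mulV.
rewrite catA -[X in word_eq _ X]cat0s; apply: word_cat; last exact: word_refl.
apply: (@word_trans (word_inv w1 ++ w1)); last exact: word_mulVl.
by apply: word_cat; [exact: word_refl | exact: word_sym].
Qed.

Definition pres_mul (x y : presented) : presented := pres_of (repr x ++ repr y).
Definition pres_inv (x : presented) : presented := pres_of (word_inv (repr x)).
Definition pres_one : presented := pres_of [::].

Lemma pres_reprP w : word_eq (repr (pres_of w)) w.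
Proof. by apply/presentedP; apply: (reprK (pres_of w)). Qed.

Lemma pres_mulE w1 w2 : pres_mul (pres_of w1) (pres_of w2) = pres_of (w1 ++ w2).
Proof. by apply/presentedP; apply: word_cat; apply: pres_reprP. Qed.

Lemma pres_invE w : pres_inv (pres_of w) = pres_of (word_inv w).
Proof. by apply/presentedP; apply: word_inv_eq; apply: pres_reprP. Qed.

Let presA : associative pres_mul.
Proof.
elim/quotW=> a; elim/quotW=> b; elim/quotW=> c.
by rewrite -!/(pres_of _) !pres_mulE catA.
Qed.
Let pres1l : left_id pres_one pres_mul.
Proof. by elim/quotW=> a; rewrite -/(pres_of a) pres_mulE. Qed.
Let pres1r : right_id pres_one pres_mul.
Proof. by elim/quotW=> a; rewrite -/(pres_of a) pres_mulE cats0. Qed.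
Let presVl : left_inverse pres_one pres_inv pres_mul.
Proof.
elim/quotW=> a; rewrite -/(pres_of a) pres_invE pres_mulE.
by apply/presentedP; apply: word_mulVl.
Qed.
Let presVr : right_inverse pres_one pres_inv pres_mul.
Proof.
elim/quotW=> a; rewrite -/(pres_of a) pres_invE pres_mulE.
by apply/presentedP; apply: word_mulV.
Qed.

HB.instance Definition _ :=
  isGroup.Build presented presA pres1l pres1r presVl presVr.

Lemma pres_ofM w1 w2 : pres_of (w1 ++ w2) = pres_of w1 * pres_of w2.
Proof. by symmetry; apply: pres_mulE. Qed.

Lemma pres_ofV w : pres_of (word_inv w) = (pres_of w)^-1.
Proof. by symmetry; apply: pres_invE. Qed.

Definition pres_gen (v : V) : presented := pres_of [:: (v, true)].

Lemma pres_ind (P : presented -> Prop) :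
  P 1 -> (forall v x, P x -> P (pres_gen v * x)) ->
  (forall v x, P x -> P ((pres_gen v)^-1 * x)) -> forall x, P x.
Proof.
move=> P1 Pg PV; elim/quotW; elim=> [//|[v b] w IH].
rewrite -/(pres_of _); have -> : pres_of ((v, b) :: w) = pres_of [:: (v, b)] * pres_of w.
  by symmetry; apply: pres_mulE.
case: b; first exact: Pg.
have -> : pres_of [:: (v, false)] = (pres_gen v)^-1.
  by symmetry; apply: pres_invE.
exact: PV.
Qed.

Section Lift.
Variables (K : groupType) (f : V -> K).

Definition word_eval (w : word V) : K :=
  \prod_(l <- w) (if l.2 then f l.1 else (f l.1)^-1).

Definition pres_lift (x : presented) : K := word_eval (repr x).

Hypothesis fR : forall r, rels r -> word_eval r = 1.

Lemma word_evalP w1 w2 : word_eq w1 w2 -> word_eval w1 = word_eval w2.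
Proof.
elim=> //; rewrite /word_eval.
- by move=> w1' w2' w3' _ -> _ ->.
- by move=> w1' w2' u1 u2 _ h1 _ h2; rewrite !big_cat /= h1 h2.
- by move=> v [] /=; rewrite !big_cons big_nil /= mulg1 ?mulgV ?mulVg.
- by move=> r /fR; rewrite big_nil.
Qed.

Lemma pres_liftE w : pres_lift (pres_of w) = word_eval w.
Proof. by apply: word_evalP; apply: pres_reprP. Qed.

Lemma pres_liftM : {morph pres_lift : x y / x * y}.
Proof.
elim/quotW=> a; elim/quotW=> b; rewrite -!/(pres_of _).
have -> : pres_of a * pres_of b = pres_of (a ++ b) by exact: pres_mulE.
by rewrite !pres_liftE /word_eval big_cat.
Qed.

Lemma pres_lift_gen v : pres_lift (pres_gen v) = f v.
Proof. by rewrite pres_liftE /word_eval big_seq1. Qed.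

End Lift.

Lemma pres_hom_ext (K : groupType) (f g : presented -> K) :
  {morph f : x y / x * y} -> {morph g : x y / x * y} ->
  (forall v, f (pres_gen v) = g (pres_gen v)) -> forall x, f x = g x.
Proof.
move=> fM gM fg.
elim/pres_ind => [|v x IH|v x IH].
- by rewrite (morph1 fM) (morph1 gM).
- by rewrite fM gM fg IH.
- by rewrite fM gM (morphV fM) (morphV gM) fg IH.
Qed.

End Presented.

Section IntPower.
Variable G : groupType.
Implicit Types (g : G) (m n : int).

Definition zexpg g m : G :=
  match m with Posz n => g ^+ n | Negz n => g ^- n.+1 end.

Lemma zexpgS g m : zexpg g (m + 1)%R = zexpg g m * g.
Proof.
case: m => n; first by rewrite -PoszD addn1 /= expgSr.
rewrite NegzE; case: n => [|n].
  by rewrite addrC subrr /= expg1 mulVg.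
have -> : (- n.+2%:Z + 1 = - n.+1%:Z)%R.
  by rewrite -[n.+2]addn1 PoszD opprD addrNK.
by rewrite -!NegzE /= [in RHS]expgS invgM mulgVK.
Qed.

Lemma zexpgD g m n : zexpg g (m + n)%R = zexpg g m * zexpg g n.
Proof.
have hN k : zexpg g (k - 1)%R = zexpg g k * g^-1.
  by rewrite -[in RHS](subrK 1%R k) zexpgS mulgK.
elim/int_ind: n => [|n IH|n IH].
- by rewrite addr0 mulg1.
- by rewrite -addn1 PoszD addrA !zexpgS IH mulgA.
- by rewrite -addn1 PoszD opprD addrA !hN IH mulgA.
Qed.

Lemma zexpg_commute g h m : commute g h -> commute g (zexpg h m).
Proof.
move=> gh; case: m => n /=; first exact: commuteX.
by apply: commuteV; apply: commuteX.
Qed.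

End IntPower.

Record sgraph := SGraph {
  vertex :> finType;
  edge : rel vertex;
  edge_sym : symmetric edge;
  edge_irr : irreflexive edge }.

Definition universal (D : sgraph) (v : D) : Prop :=
  forall w : D, w != v -> edge v w.

Section CompleteGraph.
Variable n : nat.
Let Ksym : symmetric (fun i j : 'I_n => i != j).
Proof. by move=> i j; rewrite eq_sym. Qed.
Let Kirr : irreflexive (fun i j : 'I_n => i != j).
Proof. by move=> i; rewrite eqxx. Qed.
Definition complete_graph : sgraph := SGraph Ksym Kirr.
End CompleteGraph.

Section Join.
Variables D1 D2 : sgraph.
Definition join_edge : rel (D1 + D2)%type := fun x y =>
  match x, y with
  | inl u, inl v => edge u v
  | inr u, inr v => edge u v
  | _, _ => true
  end.
Let join_sym : symmetric join_edge.
Proof. by move=> [u|u] [v|v] //=; apply: edge_sym. Qed.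
Let join_irr : irreflexive join_edge.
Proof. by move=> [u|u] /=; apply: edge_irr. Qed.
Definition graph_join : sgraph := SGraph join_sym join_irr.
End Join.

Section DeleteVertex.
Variables (D : sgraph) (v : D).
Definition del_edge : rel {w : D | w != v} := fun x y => edge (val x) (val y).
Let del_sym : symmetric del_edge.
Proof. by move=> x y; apply: edge_sym. Qed.
Let del_irr : irreflexive del_edge.
Proof. by move=> x; apply: edge_irr. Qed.
Definition graph_del : sgraph := SGraph del_sym del_irr.
End DeleteVertex.

Definition connected_graph (D : sgraph) : Prop :=
  (0 < #|D|)%N /\ forall x y : D, connect (@edge D) x y.

Definition biconnected (D : sgraph) : Prop :=
  [/\ (3 <= #|D|)%N, connected_graph D & forall v : D, connected_graph (graph_del v)].

Definition raag_rels (D : sgraph) (w : word D) : Prop :=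
  exists u v : D, edge u v /\
    w = [:: (u, true); (v, true); (u, false); (v, false)].

Notation raag D := (presented (@raag_rels D)).

Section RAAG.
Variable D : sgraph.

Definition raag_gen (v : D) : raag D := pres_gen (@raag_rels D) v.

Lemma raag_gen_commute u v : edge u v -> commute (raag_gen u) (raag_gen v).
Proof.
move=> uv; apply: (@mulIg _ (raag_gen u)^-1); apply: (@mulIg _ (raag_gen v)^-1).
rewrite mulgK mulgV /raag_gen /pres_gen.
rewrite -[LHS](_ : pres_of _ [:: (u, true); (v, true); (u, false); (v, false)] = _).
  by apply/presentedP; apply: word_rel; exists u, v.
rewrite -[[:: _; _; _; _]]/((([:: (u, true)] ++ [:: (v, true)])
  ++ word_inv [:: (u, true)]) ++ word_inv [:: (v, true)]).
by rewrite 3!pres_ofM 2!pres_ofV.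
Qed.

Section Lift.
Variables (K : groupType) (f : D -> K).
Hypothesis fC : forall u v, edge u v -> commute (f u) (f v).

Lemma raag_rels1 w : raag_rels w -> word_eval f w = 1.
Proof.
move=> [u [v [uv ->]]]; rewrite /word_eval !big_cons big_nil /= mulg1.
by rewrite !mulgA (fC uv) mulgK mulgV.
Qed.

Definition raag_lift : raag D -> K := @pres_lift D (@raag_rels D) K f.

Lemma raag_liftM : {morph raag_lift : x y / x * y}.
Proof. exact: pres_liftM raag_rels1. Qed.

Lemma raag_lift_gen v : raag_lift (raag_gen v) = f v.
Proof. exact: pres_lift_gen raag_rels1 v. Qed.

End Lift.

(* The homomorphism to Z with prescribed values f on the vertices: this is
   the identification of Z^V with Hom(A, Z). *)
Definition raag_char (f : ZgX D) : raag D -> Zg := raag_lift f.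

Let charC (f : ZgX D) u v : edge u v -> commute (f u) (f v).
Proof. by move=> _; apply: Algebra.commuteT. Qed.

Lemma raag_charM (f : ZgX D) : {morph raag_char f : x y / x * y}.
Proof. exact: raag_liftM (charC f). Qed.

HB.instance Definition _ (f : ZgX D) :=
  isMultiplicative.Build (raag D) Zg (raag_char f) (@raag_charM f).

Lemma raag_char_gen f v : raag_char f (raag_gen v) = f v.
Proof. exact: raag_lift_gen (charC f) v. Qed.

Definition raag_chi : raag D -> Zg := raag_char [ffun=> 1%R : Zg].

Lemma raag_chiM : {morph raag_chi : x y / x * y}.
Proof. exact: raag_charM. Qed.

HB.instance Definition _ :=
  isMultiplicative.Build (raag D) Zg raag_chi raag_chiM.

Lemma raag_chi_gen v : raag_chi (raag_gen v) = (1%R : int).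
Proof. by rewrite /raag_chi raag_char_gen ffunE. Qed.

Definition bb_pred : {pred raag D} := fun x => raag_chi x == 1.

Lemma bb_closed : group_closed bb_pred.
Proof.
split=> [|x y]; rewrite !unfold_in /bb_pred ?(hom1 raag_chi) // => /eqP hx /eqP hy.
by rewrite raag_chiM (homV raag_chi) /= hx hy divgg.
Qed.

Definition bb := {x : raag D | bb_pred x}.

HB.instance Definition _ := SubChoice.on bb.
HB.instance Definition _ := SubChoice_isSubGroup.Build (raag D) bb_pred bb bb_closed.

End RAAG.

Notation joinK2 D := (graph_join D (complete_graph 2)).

Section JoinK2.
Variable D : sgraph.
Notation G := (joinK2 D).

Definition join_p : G := inr ord0.
Definition join_q : G := inr ord_max.

Let inclC (u v : D) : edge u v ->
  commute (raag_gen (inl u : G)) (raag_gen (inl v : G)).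
Proof. by move=> uv; apply: raag_gen_commute. Qed.

Definition raag_inl : raag D -> raag G :=
  raag_lift (fun v => raag_gen (inl v : G)).

Lemma raag_inlM : {morph raag_inl : x y / x * y}.
Proof. exact: raag_liftM inclC. Qed.

HB.instance Definition _ :=
  isMultiplicative.Build (raag D) (raag G) raag_inl raag_inlM.

Lemma raag_inl_gen v : raag_inl (raag_gen v) = raag_gen (inl v : G).
Proof. exact: raag_lift_gen inclC v. Qed.

Notation gp := (raag_gen join_p).
Notation gq := (raag_gen join_q).

Definition iota_val (x : raag D * Zg) : raag G :=
  raag_inl x.1 * zexpg gp x.2
    * zexpg gq (- (raag_chi x.1 : int) - (x.2 : int))%R.

Lemma commute_gen_central (w : G) (x : raag G) :
  (forall v : G, v != w -> edge v w) -> commute x (raag_gen w).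
Proof.
move=> cw; elim/pres_ind: x => [|v x IH|v x IH].
- exact/commute_sym/commute1.
- apply/commute_sym/commuteM; last exact: commute_sym.
  have [->|/cw vw] := eqVneq v w; first exact: commute_refl.
  by apply/commute_sym/raag_gen_commute.
- apply/commute_sym/commuteM; last exact: commute_sym.
  apply: commuteV; have [->|/cw vw] := eqVneq v w; first exact: commute_refl.
  by apply/commute_sym/raag_gen_commute.
Qed.

Lemma commute_p x : commute x gp.
Proof.
by apply: commute_gen_central => -[v|i] //= ip; rewrite -[_ != _]/(inr i != join_p).
Qed.

Lemma commute_q x : commute x gq.
Proof.
by apply: commute_gen_central => -[v|i] //= ip; rewrite -[_ != _]/(inr i != join_q).
Qed.

Lemma raag_chi_inl x : raag_chi (raag_inl x) = raag_chi x.
Proof.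
move: x; apply: (@pres_hom_ext _ (@raag_rels D) Zg (fun x => raag_chi (raag_inl x))
  (@raag_chi D)).
- by move=> a b /=; rewrite raag_inlM raag_chiM.
- exact: raag_chiM.
- by move=> v /=; rewrite -!/(raag_gen _) raag_inl_gen !raag_chi_gen.
Qed.

Lemma raag_chi_zexp (H : sgraph) (v : H) (m : int) :
  raag_chi (zexpg (raag_gen v) m) = m.
Proof.
elim/int_ind: m => [|n IH|n IH]; first exact: hom1.
- by rewrite -addn1 PoszD zexpgS raag_chiM IH raag_chi_gen.
- rewrite -addn1 PoszD opprD; apply: (@mulIg Zg (1%R : int)).
  rewrite -[X in _ * X = _](raag_chi_gen v) -raag_chiM -zexpgS subrK IH.
  by rewrite -[RHS]/(- n%:Z - 1 + 1)%R subrK.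
Qed.

Lemma iota_subproof x : bb_pred (iota_val x).
Proof.
rewrite /bb_pred /iota_val !raag_chiM raag_chi_inl !raag_chi_zexp.
rewrite -[_ * _]/((raag_chi x.1 : int) + (x.2 : int)
  + (- (raag_chi x.1 : int) - (x.2 : int)))%R.
by rewrite -opprD subrr.
Qed.

(* (g, m) |-> g p^m q^(- chi(g) - m) *)
Definition bb_iota (x : raag D * Zg) : bb G := Sub (iota_val x) (iota_subproof x).

Let commute_zq x m : commute x (zexpg gq m).
Proof. exact/zexpg_commute/commute_q. Qed.
Let commute_zp x m : commute x (zexpg gp m).
Proof. exact/zexpg_commute/commute_p. Qed.

Lemma iotaM : {morph bb_iota : x y / x * y}.
Proof.
move=> x y; apply: val_inj; rewrite valM /= /iota_val /= raag_inlM raag_chiM.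
rewrite -[raag_chi x.1 * raag_chi y.1]/((raag_chi x.1 : int) + (raag_chi y.1 : int))%R.
rewrite -[x.2 * y.2]/((x.2 : int) + (y.2 : int))%R.
have -> (i j k l : int) : (- (i + j) - (k + l) = (- i - k) + (- j - l))%R.
  by rewrite !opprD addrACA.
rewrite (zexpgD gp) (zexpgD gq).
set a := raag_inl x.1; set b := raag_inl y.1.
set P := zexpg gp _; set Q := zexpg gq _.
set P' := zexpg gp _; set Q' := zexpg gq _.
have -> : a * P * Q * (b * P' * Q') = a * P * (Q * (b * P')) * Q'.
  by rewrite !mulgA.
rewrite -[Q * (b * P')](commute_zq (b * P')).
have -> : a * P * (b * P' * Q) * Q' = a * (P * b) * P' * Q * Q'.
  by rewrite !mulgA.
by rewrite -[P * b](commute_zp b) !mulgA.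
Qed.

Definition iota_inv_gen (v : G) : raag D * Zg :=
  match v with
  | inl u => (raag_gen u, 1)
  | inr i => (1, (if i == ord0 then 1%R else 0%R) : Zg)
  end.

Let iota_invC (u v : G) : edge u v -> commute (iota_inv_gen u) (iota_inv_gen v).
Proof.
case: u v => [u|i] [v|j] /= uv; congr (_, _) => /=.
all: rewrite ?mul1g ?mulg1 //.
- exact: raag_gen_commute.
- exact: Algebra.commuteT.
Qed.

Definition iota_inv_raag : raag G -> raag D * Zg := raag_lift iota_inv_gen.

Lemma iota_inv_raagM : {morph iota_inv_raag : x y / x * y}.
Proof. exact: raag_liftM iota_invC. Qed.

HB.instance Definition _ := isMultiplicative.Build (raag G) (raag D * Zg)%type
  iota_inv_raag iota_inv_raagM.

Lemma iota_inv_raag_gen v : iota_inv_raag (raag_gen v) = iota_inv_gen v.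
Proof. exact: raag_lift_gen iota_invC v. Qed.

Lemma hom_zexpg (H K : groupType) (f : {multiplicative H -> K}) g m :
  f (zexpg g m) = zexpg (f g) m.
Proof.
have fX n : f (g ^+ n) = f g ^+ n.
  by elim: n => [|n IH]; rewrite ?expg0 ?hom1 // !expgS gmulfM IH.
by case: m => n /=; rewrite ?homV fX.
Qed.

Lemma zexpg_pair (H K : groupType) (x : H * K) m :
  zexpg x m = (zexpg x.1 m, zexpg x.2 m).
Proof.
have e1 := @hom_zexpg (H * K)%type H fst x m.
have e2 := @hom_zexpg (H * K)%type K snd x m.
by rewrite [LHS]surjective_pairing /= -e1 -e2.
Qed.

Lemma zexpg_one (H : groupType) m : zexpg (1 : H) m = 1.
Proof. by case: m => n /=; rewrite expg1n ?invg1. Qed.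

Lemma zexpg_Zg (m : int) : zexpg (1%R : Zg) m = m.
Proof.
elim/int_ind: m => [//|n IH|n IH].
- by rewrite -addn1 PoszD zexpgS IH.
- rewrite -addn1 PoszD opprD; apply: (@mulIg Zg (1%R : int)).
  rewrite -zexpgS subrK IH.
  by rewrite -[RHS]/(- n%:Z - 1 + 1)%R subrK.
Qed.

Definition iota_inv (x : bb G) : raag D * Zg := iota_inv_raag (val x).

Lemma iotaK : cancel bb_iota iota_inv.
Proof.
case=> g m; rewrite /iota_inv /= /iota_val /= !iota_inv_raagM.
rewrite !(hom_zexpg iota_inv_raag) /= !iota_inv_raag_gen /=.
have -> : iota_inv_raag (raag_inl g) = (g, 1).
  move: g; apply: (@pres_hom_ext _ (@raag_rels D) (raag D * Zg)%type
    (fun g => iota_inv_raag (raag_inl g)) (fun g => (g, 1))).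
  - by move=> a b /=; rewrite raag_inlM iota_inv_raagM.
  - by move=> a b; congr (_, _); rewrite mulg1.
  - by move=> v /=; rewrite -!/(raag_gen _) raag_inl_gen iota_inv_raag_gen.
rewrite !zexpg_pair /= !zexpg_one zexpg_Zg.
by congr (_, _); rewrite /= ?mulg1 ?mul1g.
Qed.

Lemma iotaVK : cancel iota_inv bb_iota.
Proof.
move=> [x xH]; apply: val_inj => /=; rewrite /iota_inv /=.
pose F (x : raag G) := let y := iota_inv_raag x in raag_inl y.1
  * zexpg gp y.2 * zexpg gq ((raag_chi x : int) - (raag_chi y.1 : int) - (y.2 : int))%R.
have FM : {morph F : a b / a * b}.
  move=> a b; rewrite /F iota_inv_raagM /=.
  move: (iota_inv_raag a) (iota_inv_raag b) => c d /=.
  rewrite raag_inlM !raag_chiM.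
  rewrite -[_ * raag_chi b]/((raag_chi a : int) + (raag_chi b : int))%R.
  rewrite -[_ * raag_chi d.1]/((raag_chi c.1 : int) + (raag_chi d.1 : int))%R.
  rewrite -[c.2 * d.2]/((c.2 : int) + (d.2 : int))%R.
  have -> (z1 z2 z3 z4 z5 z6 : int) : (z1 + z2 - (z3 + z4) - (z5 + z6)
     = (z1 - z3 - z5) + (z2 - z4 - z6))%R.
    by rewrite !opprD (addrACA z1) (addrACA (z1 - z3)%R).
  rewrite (zexpgD gp) (zexpgD gq).
  set a' := raag_inl c.1; set b' := raag_inl d.1.
  set P := zexpg gp _; set P' := zexpg gp _.
  set Q := zexpg gq _; set Q' := zexpg gq _.
  have -> : a' * P * Q * (b' * P' * Q') = a' * P * (Q * (b' * P')) * Q'.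
    by rewrite !mulgA.
  rewrite -[Q * (b' * P')](commute_zq (b' * P')).
  have -> : a' * P * (b' * P' * Q) * Q' = a' * (P * b') * P' * Q * Q'.
    by rewrite !mulgA.
  by rewrite -[P * b'](commute_zp b') !mulgA.
have -> : iota_val (iota_inv_raag x) = F x.
  rewrite /iota_val /F; have -> : raag_chi x = (0%R : int) by exact/eqP.
  by rewrite sub0r.
move: x {xH}; apply: (@pres_hom_ext _ (@raag_rels G) _ F id FM) => // v.
rewrite -/(raag_gen v) /F iota_inv_raag_gen raag_chi_gen.
case: v => [v|i] /=.
  by rewrite raag_inl_gen raag_chi_gen -[RHS]mulg1 -[X in _ = X * _]mulg1.
rewrite (hom1 raag_inl) (hom1 (@raag_chi D)) mul1g.
have [->|i0] := eqVneq i ord0; first by rewrite -[RHS]mulg1.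
have -> : i = ord_max.
  by apply: val_inj; case: i i0 => -[|[|]].
by rewrite -[RHS]mul1g.
Qed.

Definition iota_iso : giso (raag D * Zg)%type (bb G) := Giso iotaM iotaK iotaVK.

End JoinK2.
Section Embedding.
Variable D : sgraph.
Local Notation A := (raag D).
Local Notation H := (bb (joinK2 D)).
Local Notation bb_iota := (@bb_iota D).
Local Notation iota_iso := (iota_iso D).

Section ProdId.
Variable a : Aut A.
Let f (x : A * Zg) : A * Zg := (a x.1, x.2).
Let f' (x : A * Zg) : A * Zg := (giso_inv a x.1, x.2).
Let fM : {morph f : x y / x * y}.
Proof. by move=> x y; rewrite /f /= gisoM. Qed.
Let fK : cancel f f'.
Proof. by case=> g m; rewrite /f /f' /= gisoK. Qed.
Let fVK : cancel f' f.
Proof. by case=> g m; rewrite /f /f' /= gisoVK. Qed.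
Definition aut_prod_id : Aut (A * Zg)%type := Giso fM fK fVK.
End ProdId.

Definition aut_emb (a : Aut A) : Aut H :=
  giso_comp iota_iso (giso_comp (aut_prod_id a) (giso_sym iota_iso)).

Lemma aut_embE a g m : aut_emb a (bb_iota (g, m)) = bb_iota (a g, m).
Proof. by rewrite /= iotaK. Qed.

Lemma aut_embM : {morph aut_emb : a b / a * b}.
Proof. by move=> a b; apply: gisoP => x /=; rewrite iotaK. Qed.

HB.instance Definition _ :=
  isMultiplicative.Build (Aut A) (Aut H) aut_emb aut_embM.

Lemma aut_emb_Inn g : aut_emb (Inn g) = Inn (bb_iota (g, 1)).
Proof.
apply: gisoP => x; rewrite -(iotaVK x); case: (iota_inv x) => h m.
rewrite aut_embE /= -(morphV (@iotaM D)) -!iotaM; congr bb_iota; congr (_, _).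
by rewrite /= invg1 mulg1 mul1g.
Qed.

Definition out_emb (x : Out A) : Out H := out_of (aut_emb (repr x)).

Lemma out_embE a : out_emb (out_of a) = out_of (aut_emb a).
Proof.
rewrite /out_emb; have [g ->] := out_reprP a.
by apply/out_ofP; exists (bb_iota (g, 1)); rewrite aut_embM aut_emb_Inn.
Qed.

Lemma out_embM : {morph out_emb : x y / x * y}.
Proof.
move=> x y; have [a <-] := out_of_surj x; have [b <-] := out_of_surj y.
by rewrite -out_ofM !out_embE aut_embM out_ofM.
Qed.

HB.instance Definition _ :=
  isMultiplicative.Build (Out A) (Out H) out_emb out_embM.

End Embedding.

Section Actions.
Variable D : sgraph.
Local Notation A := (raag D).

Definition sgnZ2 (k : Z2g) : int := ((-1) ^+ (k : 'Z_2))%R.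

Lemma sgnZ2M (k l : Z2g) : sgnZ2 (k * l) = (sgnZ2 k * sgnZ2 l)%R.
Proof.
rewrite /sgnZ2 -[(k * l)%g]/((k : 'Z_2) + (l : 'Z_2))%R -exprD -[LHS]signr_odd.
by rewrite -[RHS]signr_odd /= odd_mod.
Qed.

(* (a, k) . h = k (h o a^-1), a homomorphism h being encoded by its values on
   the vertices. *)
Definition aut_act_fun (x : Aut A * Z2g) (f : ZgX D) : ZgX D :=
  [ffun v => (sgnZ2 x.2 * (raag_char f (x.1^-1%g (raag_gen v)) : int))%R : Zg].

Lemma aut_act_char x f g :
  raag_char (aut_act_fun x f) g
    = (sgnZ2 x.2 * (raag_char f (x.1^-1%g g) : int))%R.
Proof.
move: g; apply: (@pres_hom_ext _ (@raag_rels D) Zg _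
  (fun g => (sgnZ2 x.2 * (raag_char f (x.1^-1%g g) : int))%R : Zg)).
- exact: raag_charM.
- by move=> a b; rewrite gisoM raag_charM; apply: mulrDr.
- by move=> v; rewrite -/(raag_gen v) raag_char_gen ffunE.
Qed.

Let aut_act1 f : aut_act_fun 1 f = f.
Proof.
by apply/ffunP => v; rewrite ffunE /= raag_char_gen /sgnZ2 expr0 mul1r.
Qed.

Let aut_actA x y f : aut_act_fun (x * y) f = aut_act_fun x (aut_act_fun y f).
Proof.
apply/ffunP => v; by rewrite !ffunE aut_act_char /= sgnZ2M -mulrA.
Qed.

Let aut_actM x : {morph aut_act_fun x : f g / f * g}.
Proof.
move=> f g; apply/ffunP => v; rewrite !ffunE.
have -> h : raag_char (f * g) h = raag_char f h * raag_char g h.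
  move: h; apply: (@pres_hom_ext _ (@raag_rels D) Zg _
    (fun h => raag_char f h * raag_char g h)).
  - exact: raag_charM.
  - by move=> a b; rewrite !raag_charM; apply: addrACA.
  - by move=> w; rewrite -/(raag_gen w) !raag_char_gen ffunE.
exact: mulrDr.
Qed.

Definition aut_act : gaction (Aut A * Z2g)%type (ZgX D) :=
  Gaction aut_act1 aut_actA aut_actM.

Definition out_act_fun (x : Out A * Z2g) (f : ZgX D) : ZgX D :=
  aut_act_fun (repr x.1, x.2) f.

(* Inner automorphisms act trivially, as Z is abelian. *)
Lemma out_act_funE a k f : out_act_fun (out_of a, k) f = aut_act_fun (a, k) f.
Proof.
apply/ffunP => v; rewrite !ffunE; congr (_ * _)%R.
change (raag_char f ((repr (out_of a))^-1 (raag_gen v))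
  = raag_char f (a^-1 (raag_gen v))).
have [g ->] := out_reprP a.
have inn F h : raag_char F ((Inn g)^-1 h) = raag_char F h.
  rewrite /= !raag_charM (morphV (@raag_charM D F)).
  by rewrite [_^-1 * _]Algebra.commuteT mulgVK.
have e h : raag_char f (a^-1 h) = raag_char (aut_act_fun (a, 1) f) h.
  by rewrite aut_act_char /sgnZ2 expr0 mul1r.
by rewrite invgM autM_E !e inn.
Qed.

Let out_act1 f : out_act_fun 1 f = f.
Proof. by rewrite -[1]/(out_of 1, 1) out_act_funE; apply: aut_act1. Qed.

Let out_actA x y f : out_act_fun (x * y) f = out_act_fun x (out_act_fun y f).
Proof.
case: x y => [x k] [y l].
have [a <-] := out_of_surj x; have [b <-] := out_of_surj y.
rewrite -[_ * _]/(out_of a * out_of b, k * l) -out_ofM !out_act_funE.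
exact: (aut_actA (a, k) (b, l)).
Qed.

Let out_actM x : {morph out_act_fun x : f g / f * g}.
Proof. exact: aut_actM. Qed.

Definition out_act : gaction (Out A * Z2g)%type (ZgX D) :=
  Gaction out_act1 out_actA out_actM.

End Actions.

Section TypeF.
Local Open Scope classical_set_scope.
Local Open Scope ring_scope.
Variable R : realType.

(* Cells are modelled on [0, 1]^n, which is homeomorphic to the closed disc;
   'rV[R]_n carries the product topology. *)
Definition cube n : set 'rV[R]_n := [set x | forall i, 0 <= x ord0 i <= 1].
Definition open_cube n : set 'rV[R]_n := [set x | forall i, 0 < x ord0 i < 1].

(* X is a Hausdorff space with a finite cell decomposition given by
   characteristic maps phi i.  Closure-finiteness and the weak topology are
   automatic, there being finitely many cells. *)
Definition finite_CW (X : topologicalType) : Prop :=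
  hausdorff_space X /\
  exists (I : finType) (d : I -> nat) (phi : forall i, 'rV[R]_(d i) -> X),
    [/\ forall i, {within @cube (d i), continuous (phi i)},
        forall i, set_inj (@open_cube (d i)) (phi i),
        forall x, exists! i, (phi i @` @open_cube (d i)) x &
        forall i x, @cube (d i) x -> ~ @open_cube (d i) x ->
          exists2 j, (d j < d i)%N & (phi j @` @open_cube (d j)) (phi i x)].

Definition contractible (E : topologicalType) : Prop :=
  exists (e0 : E) (h : E * R -> E),
    [/\ {within setT `*` `[0, 1], continuous h},
        forall e, h (e, 0) = e & forall e, h (e, 1) = e0].

(* X is the orbit space, with the quotient topology, of a covering space
   action of the discrete group G on a contractible space. *)
Definition classifying_space (G : groupType) (X : topologicalType) : Prop :=
  exists (E : topologicalType) (act : G -> E -> E) (p : E -> X),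
    contractible E /\
    [/\ forall e, act 1%g e = e,
        forall g h e, act (g * h)%g e = act g (act h e),
        forall g, continuous (act g) &
        forall e, exists2 U, open_nbhs e U &
          forall g, g <> 1%g -> U `&` act g @` U = set0] /\
    [/\ forall x, exists e, p e = x,
        forall e e', p e = p e' <-> exists g, e' = act g e &
        forall U : set X, open U <-> open (p @^-1` U)].

Definition type_F (G : groupType) : Prop :=
  exists2 X : topologicalType, finite_CW X & classifying_space G X.

End TypeF.

Definition group_retract (G H : groupType) : Prop :=
  exists (s : {multiplicative G -> H}) (r : {multiplicative H -> G}), cancel s r.

(* Main.v *)
From HB Require Import structures.
Require Import Defs.
From mathcomp Require Import all_boot all_order all_algebra.
From mathcomp Require Import all_classical all_reals all_analysis.
From mathcomp Require Import ring lra.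
Import Order.TTheory GRing.Theory Num.Theory.
Import numFieldNormedType.Exports.

(* Let A be the right-angled Artin group of D.  A word in the generators is a
   path in the Cayley graph, whose edges are dual to hyperplanes: the edges
   (a, a v) and (b, b v) are dual to the same one when b is in a C_v, where C_v
   is generated by the vertices adjacent to v.  The parity of the number of
   crossings of a given hyperplane depends only on the endpoints of the path,
   because it is invariant under the defining relations.  So every hyperplane
   has two sides, and a path crossing one twice can be shortened by
   commutation.  This solves the word problem; it also shows that two letters
   that can both come first in a geodesic word for an element are adjacent, so
   A is centerless if no vertex is universal.

   When A is centerless, an automorphism of A x Z preserves the factor Z, acts
   on it by a sign, induces an automorphism of A, and is then determined by a
   homomorphism from A to Z.

   For type F, the universal cover of the Salvetti complex is realized inside
   the product of the intervals [0, 1] indexed by the hyperplanes, so that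
   continuity is checked one coordinate at a time.  It is contracted by erasing
   each point's letters in decreasing order of their distance from 1.  The
   group A x Z is itself the right-angled Artin group of a cone. *)

Set Implicit Arguments.
Unset Strict Implicit.
Unset Printing Implicit Defensive.

Local Open Scope group_scope.
Local Open Scope quotient_scope.

(** * Hyperplanes and geodesic words *)

Local Notation word_of w := (pres_of _ w).

Section Raag.
Variable D : sgraph.
Local Notation A := (raag D).
Implicit Types (u v : D) (l m : D * bool) (w : word D) (g h c p q : A).

Definition letter l : A := pres_of _ [:: l].
Definition linv l : D * bool := (l.1, ~~ l.2).

Lemma letterV l : letter (linv l) = (letter l)^-1.
Proof. by rewrite /letter -pres_ofV. Qed.

Lemma pres_cons l w : word_of (l :: w) = letter l * word_of w :> A.
Proof. by rewrite -pres_ofM. Qed.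

Lemma pres_rcons w l : word_of (rcons w l) = word_of w * letter l :> A.
Proof. by rewrite -cats1 pres_ofM. Qed.

Lemma pres_nil : word_of [::] = 1 :> A. Proof. by []. Qed.

Lemma pres_surj g : exists w, word_of w = g.
Proof. by exists (repr g); apply: reprK. Qed.

Lemma letterC l m : edge l.1 m.1 -> commute (letter l) (letter m).
Proof.
move=> lm; have key v b (x : A) : commute x (raag_gen v) -> commute x (letter (v, b)).
  case: b => // xv; rewrite -[(v, false)]/(linv (v, true)) letterV.
  exact: commuteV.
case: l m lm => [u b] [v b'] /= uv; apply/key/commute_sym/key/commute_sym.
exact: raag_gen_commute.
Qed.

(** Membership in the subgroup [C_v] generated by the link of [v]; the hyperplanes labelled [v]
    correspond to its left cosets. *)
Definition inlk v g : bool :=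
  `[< exists2 w, all (fun l => edge v l.1) w & g = word_of w >].

Lemma inlk1 v : inlk v 1.
Proof. by apply/asboolP; exists [::]. Qed.

Lemma inlkM v g h : inlk v g -> inlk v h -> inlk v (g * h).
Proof.
move=> /asboolP[w1 a1 ->] /asboolP[w2 a2 ->]; apply/asboolP.
by exists (w1 ++ w2); rewrite ?all_cat ?a1 // pres_ofM.
Qed.

Lemma inlkV v g : inlk v g^-1 = inlk v g.
Proof.
have sub x : inlk v x -> inlk v x^-1.
  move=> /asboolP[w a ->]; apply/asboolP; exists (word_inv w); last by rewrite pres_ofV.
  by rewrite /word_inv all_rev all_map; apply: sub_all a => -[].
by apply/idP/idP => /sub //; rewrite invgK.
Qed.

Lemma inlkMr v g h : inlk v h -> inlk v (g * h) = inlk v g.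
Proof.
move=> hh; apply/idP/idP => hg; last exact: inlkM.
by rewrite -(mulgK h g); apply: inlkM; rewrite ?inlkV.
Qed.

Lemma inlkMl v g h : inlk v h -> inlk v (h * g) = inlk v g.
Proof.
move=> hh; apply/idP/idP => hg; last exact: inlkM.
by rewrite -(mulKg h g); apply: inlkM; rewrite ?inlkV.
Qed.

Lemma inlk_letter v l : edge v l.1 -> inlk v (letter l).
Proof. by move=> vl; apply/asboolP; exists [:: l]; rewrite //= vl. Qed.

Lemma inlkC v g l : inlk v g -> l.1 = v -> commute g (letter l).
Proof.
move=> /asboolP[w + ->] lv; elim: w => [|m w IH] /=.
  by move=> _; apply/commute_sym/commute1.
case/andP=> vm /IH; rewrite pres_cons => wl.
apply/commute_sym/commuteM; last exact: commute_sym.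
by apply: letterC; rewrite lv.
Qed.

(* The edge from p to p * l crosses the hyperplane dual to the edge from 1 to
   v. *)
Definition crosses v p l : bool :=
  (l.1 == v) && inlk v (if l.2 then p else p * letter l).

Fixpoint crossings v p w : bool :=
  if w is l :: w' then crosses v p l (+) crossings v (p * letter l) w' else false.

Lemma crossings_cat v p w1 w2 :
  crossings v p (w1 ++ w2) = crossings v p w1 (+) crossings v (p * word_of w1) w2.
Proof.
elim: w1 p => [|l w1 IH] p /=; first by rewrite pres_nil mulg1.
by rewrite IH pres_cons mulgA addbA.
Qed.

Lemma crosses_linv v p l : crosses v (p * letter l) (linv l) = crosses v p l.
Proof.
by rewrite /crosses /= letterV mulgK; case: l.2; case: eqP.
Qed.

(** A cancelling pair crosses one hyperplane back and forth. The boundary of a commutation square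
    crosses each of its two hyperplanes twice, opposite sides being dual to the same one. *)
Lemma crossings_eq v w1 w2 : word_eq (@raag_rels D) w1 w2 ->
  forall p, crossings v p w1 = crossings v p w2.
Proof.
elim=> {w1 w2} //.
- by move=> w2 w1 w3 _ h1 _ h2 p; rewrite h1.
- move=> w1 w2 u1 u2 e1 h1 _ h2 p; rewrite !crossings_cat h1 h2; congr (_ (+) _).
  by congr (crossings _ (_ * _) _); apply/presentedP.
- by move=> u b p /=; rewrite -[(u, ~~ b)]/(linv (u, b)) crosses_linv addbF addbb.
- move=> r [x [y [xy ->]]] p.
  have xyC := letterC (l := (x, true)) (m := (y, true)) xy.
  have side z z' q : edge z z' -> z = v \/ z' = v ->
      crosses v (q * letter (z, true)) (z', true) = crosses v q (z', true).
    move=> zz' zv; rewrite /crosses /=; case: (eqVneq z' v) => //= e.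
    by rewrite inlkMr // inlk_letter // -e edge_sym.
  case: (eqVneq x v) => [xv|xv]; last case: (eqVneq y v) => [yv|yv].
  + have yv : y != v by apply/eqP => e; move: xy; rewrite xv e edge_irr.
    rewrite /= !{2 4}/crosses /= (negPf yv) /=.
    have -> : p * letter (x, true) * letter (y, true)
        = p * letter (y, true) * letter (x, true) by rewrite -!mulgA xyC.
    rewrite -[(x, false)]/(linv (x, true)) crosses_linv side //; last by right.
      by rewrite !addbF addbb.
    by rewrite edge_sym.
  + subst v; rewrite /= /crosses /= (negPf xv) eqxx /= addbF.
    rewrite -[(x, false)]/(linv (x, true)) -[(y, false)]/(linv (y, true)) !letterV.
    have -> : p * letter (x, true) * letter (y, true) * (letter (x, true))^-1
        * (letter (y, true))^-1 = p.
      by rewrite -(mulgA p) xyC !mulgA !mulgK.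
    by rewrite inlkMr ?addbb // inlk_letter //= edge_sym.
  + by rewrite /= /crosses /= (negPf xv) (negPf yv).
Qed.

(* g lies on the far side, seen from 1, of the hyperplane dual to the edge
   from 1 to v. *)
Definition beyond v g : bool := crossings v 1 (repr g).

Lemma beyond_word v w : beyond v (word_of w) = crossings v 1 w.
Proof. exact/crossings_eq/pres_reprP. Qed.

Lemma beyond1 v : beyond v 1 = false.
Proof. by rewrite -pres_nil beyond_word. Qed.

Lemma beyondM v g l : beyond v (g * letter l) = beyond v g (+) crosses v g l.
Proof.
have [w <-] := pres_surj g.
by rewrite -pres_rcons -cats1 !beyond_word crossings_cat /= mul1g addbF.
Qed.

Lemma beyondM_neq v g l : l.1 != v -> beyond v (g * letter l) = beyond v g.
Proof. by move=> lv; rewrite beyondM /crosses (negPf lv) addbF. Qed.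

Lemma beyondM_lk u v g c : ~~ edge u v -> inlk u c -> beyond v (g * c) = beyond v g.
Proof.
move=> uv /asboolP[w + ->]; elim: w g => [|l w IH] g /=; first by rewrite mulg1.
case/andP=> ul /IH; rewrite pres_cons mulgA => ->.
by rewrite beyondM_neq //; apply: contraNneq uv => <-.
Qed.

Lemma beyond_lk v g : inlk v g -> beyond v g = false.
Proof.
by move=> vg; rewrite -(mul1g g) (@beyondM_lk v) ?beyond1 ?edge_irr.
Qed.

(** [C_v] stabilizes the hyperplane dual to the edge from 1 to [v], and preserves its sides because
    [c] itself lies on the side of 1. *)
Lemma beyond_lkM v c g : inlk v c -> beyond v (c * g) = beyond v g.
Proof.
move=> vc; have [w <-] := pres_surj g.
elim/last_ind: w => [|w l IH]; first by rewrite pres_nil mulg1 beyond1 beyond_lk.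
rewrite pres_rcons mulgA !beyondM IH /crosses -[c * _ * _]mulgA.
by case: l.2; rewrite (inlkMl _ vc).
Qed.

Lemma beyond_letter v g : beyond v (g * letter (v, true)) = beyond v g || inlk v g.
Proof.
rewrite beyondM /crosses eqxx /=; case E: (inlk v g); last by rewrite addbF orbF.
by rewrite beyond_lk.
Qed.

Lemma beyond_gen v : beyond v (letter (v, true)).
Proof. by rewrite -(mul1g (letter _)) beyond_letter beyond1 inlk1. Qed.

Lemma inlk_gen v b : inlk v (letter (v, b)) = false.
Proof.
apply/negP => h; have {h} : inlk v (letter (v, true)).
  by case: b h => //; rewrite -[(v, false)]/(linv (v, true)) letterV inlkV.
by move/beyond_lk; rewrite beyond_gen.
Qed.

Let word_len g n : bool := `[< exists2 w, word_of w = g & size w = n >].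

Let word_lenP g : exists n, word_len g n.
Proof.
by have [w wg] := pres_surj g; exists (size w); apply/asboolP; exists w.
Qed.

Definition len g : nat := ex_minn (word_lenP g).
Arguments len g%_g.

Lemma geodesic g : exists2 w, word_of w = g & size w = len g.
Proof. by rewrite /len; case: ex_minnP => n /asboolP. Qed.

Lemma len_word w : (len (word_of w) <= size w)%N.
Proof. by rewrite /len; case: ex_minnP => n _; apply; apply/asboolP; exists w. Qed.

Lemma lenM g h : (len (g * h) <= len g + len h)%N.
Proof.
have [w <- <-] := geodesic g; have [w' <- <-] := geodesic h.
by rewrite -pres_ofM -size_cat len_word.
Qed.

Lemma lenV g : len g^-1 = len g.
Proof.
have sub x : (len x^-1 <= len x)%N.
  have [w <- <-] := geodesic x; rewrite -pres_ofV.
  by rewrite (leq_trans (len_word _)) // /word_inv size_rev size_map.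
by apply/eqP; rewrite eqn_leq sub -{1}(invgK g) sub.
Qed.

Lemma len_letter l : (len (letter l) <= 1)%N.
Proof. exact: len_word. Qed.

(** Relators and cancelling pairs have even length, so length modulo 2 is an invariant of the
    element, and a letter always changes [len]. *)
Lemma odd_size w1 w2 : word_eq (@raag_rels D) w1 w2 -> odd (size w1) = odd (size w2).
Proof.
elim=> {w1 w2} //.
- by move=> w2 w1 w3 _ -> _ ->.
- by move=> w1 w2 u1 u2 _ h1 _ h2; rewrite !size_cat !oddD h1 h2.
- by move=> r [x [y [_ ->]]].
Qed.

Lemma odd_lenM g l : odd (len (g * letter l)) = ~~ odd (len g).
Proof.
have [w wg <-] := geodesic g; have [w' w'g <-] := geodesic (g * letter l).
rewrite (@odd_size w' (rcons w l)) ?size_rcons //.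
by apply/presentedP; rewrite w'g pres_rcons wg.
Qed.

Lemma lenM_neq g l : len (g * letter l) != len g.
Proof. by apply/eqP => e; move: (odd_lenM g l); rewrite e; case: odd. Qed.

(* The positively oriented edge joining p and p * l starts at edge_base p l. *)
Definition edge_base p l : A := if l.2 then p else p * letter l.

Lemma beyond_base p l : beyond l.1 ((edge_base p l)^-1 * p) = ~~ l.2.
Proof.
case: l => v [] /=; first by rewrite mulVg beyond1.
rewrite invgM mulgVK -letterV; exact: beyond_gen.
Qed.

Lemma edge_base_linv p l : edge_base (p * letter l) (linv l) = edge_base p l.
Proof. by rewrite /edge_base letterV mulgK /=; case: l.2. Qed.

Lemma crosses_base v a q l : crosses v (a^-1 * q) l =
  (l.1 == v) && inlk v (a^-1 * edge_base q l).
Proof. by rewrite /crosses /edge_base; case: l.2; rewrite ?mulgA. Qed.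

(** By induction on [w]; the letter found is the first one that leads to the side of the
    endpoint. *)
Lemma last_crossing v a q w :
  beyond v (a^-1 * q) != beyond v (a^-1 * (q * word_of w)) ->
  exists w1 l w2, [/\ w = w1 ++ l :: w2, crosses v (a^-1 * (q * word_of w1)) l &
    beyond v (a^-1 * (q * word_of w1 * letter l)) = beyond v (a^-1 * (q * word_of w))].
Proof.
elim: w q => [|l w IH] q; first by rewrite pres_nil mulg1 eqxx.
rewrite pres_cons (mulgA q) => hq.
have [e|ne] := eqVneq (beyond v (a^-1 * (q * letter l)))
    (beyond v (a^-1 * (q * letter l * word_of w))).
  exists [::], l, w; split; rewrite // ?pres_nil ?mulg1 //.
  move: hq; rewrite -e !mulgA beyondM.
  by case: (beyond _ _); case: crosses.
have [w1 [m [w2 [-> c b]]]] := IH _ ne.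
by exists (l :: w1), m, w2; split; rewrite // pres_cons (mulgA q).
Qed.

(** The hypothesis says that the hyperplane dual to the edge from [p] to [p * letter l] separates 1
    from [p]. A geodesic word for [p] crosses it at a letter [m] inverse to [l]; the rest [w2]
    commutes with [l], so [l] cancels against [m]. *)
Lemma len_step_lt p l : beyond l.1 (edge_base p l)^-1 = l.2 ->
  (len (p * letter l) < len p)%N.
Proof.
move=> bl; set a := edge_base p l in bl; set v := l.1 in bl.
have bp : beyond v (a^-1 * p) = ~~ l.2 by apply: beyond_base.
have [w wp sw] := geodesic p.
have [|w1 [m [w2 [ew cm bm]]]] := @last_crossing v a 1 w.
  by rewrite mulg1 mul1g wp bl bp; case: l.2.
rewrite !mul1g wp bp in cm bm.
have mv : m.1 = v by move: cm => /andP[/eqP].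
move: (cm); rewrite crosses_base => /andP[_ cm'].
have ep : p = word_of w1 * letter m * word_of w2.
  by rewrite -wp ew pres_ofM pres_cons mulgA.
(* After [m] the path is on the side of [p], so [m] crosses in the direction opposite to the step
   [l] from [p]. *)
have eml : m = linv l.
  rewrite [m]surjective_pairing mv /linv; congr (_, _).
  move: cm bm; rewrite /crosses mv eqxx /= mulgA [in letter m](surjective_pairing m) mv.
  case: m.2 => [c1|/beyond_lk ->]; last by case: l.2.
  by rewrite beyond_letter c1 orbT; case: l.2.
(* The edges of [m] and [l] are dual to the same hyperplane, and [w2] joins their ends on the same
   side of it. *)
have w2v : inlk v (word_of w2).
  move: cm'; rewrite /edge_base eml /= /a /edge_base.
  rewrite ep eml letterV; case: l.2 => /=.
    by rewrite invgM mulgVK inlkV.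
  rewrite -inlkV invgM invgK !mulgA mulVg mul1g => h.
  have := inlkC h (erefl : l.1 = v).
  by rewrite /commute !mulgA mulgV mul1g => /(@mulIg _ _) <-.
have -> : p * letter l = word_of (w1 ++ w2).
  rewrite ep eml letterV -mulgA (inlkC w2v (erefl : l.1 = v)) !mulgA mulgVK.
  by rewrite pres_ofM.
by rewrite (leq_ltn_trans (len_word _)) // -sw ew !size_cat /= addnS ltnS.
Qed.

(** When 1 is on the side of [p], [len_step_lt] applied to the reversed edge makes [p] the shorter
    end. *)
Lemma len_step p l :
  (len (p * letter l) < len p)%N = (beyond l.1 (edge_base p l)^-1 == l.2).
Proof.
apply/idP/eqP => [|/len_step_lt //]; apply: contraTeq => h; rewrite -leqNgt ltnW //.
rewrite -{1}(mulgK (letter l) p) -letterV; apply: len_step_lt.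
by rewrite edge_base_linv /=; move: h; case: beyond; case: l.2.
Qed.

Lemma len_step_gt p l :
  (len p < len (p * letter l))%N = (beyond l.1 (edge_base p l)^-1 != l.2).
Proof. by rewrite -len_step -leqNgt ltn_neqAle eq_sym lenM_neq. Qed.

(** If [g] and [h] differ, the hyperplane dual to the first edge of a geodesic from [g] to [h]
    separates them. *)
Lemma beyond_inj g h :
  (forall v a, beyond v (a * g) = beyond v (a * h)) -> g = h.
Proof.
move=> gh; apply: (@mulgI _ g^-1); rewrite mulVg; symmetry; set k := g^-1 * h.
have {gh} bk v a : beyond v (a * k) = beyond v a.
  by rewrite /k mulgA -gh mulgVK.
have [[|l w] kw sw] := geodesic k; first by rewrite -kw.
have : (len (k^-1 * letter l) < len k^-1)%N.
  rewrite -lenV invgM invgK -letterV lenV -sw ltnS -{1}kw pres_cons letterV mulKg.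
  exact: len_word.
rewrite len_step => /eqP e.
by move: (beyond_base k^-1 l); rewrite -(bk l.1) mulgVK e; case: l.2.
Qed.

End Raag.
Arguments len {D} g%_g.

(** * First letters of geodesic words, and the center *)

Section RaagCenter.
Variable D : sgraph.
Local Notation A := (raag D).
Implicit Types (u v : D) (l m : D * bool) (w : word D) (g h c p q : A).

Lemma pres_ind_r (P : A -> Prop) :
  P 1 -> (forall g l, P g -> P (g * letter l)) -> forall g, P g.
Proof.
move=> P1 Pl g; have [w <-] := pres_surj g.
by elim/last_ind: w => [//|w l IH]; rewrite pres_rcons; apply: Pl.
Qed.

(** The hyperplane dual to the edge from 1 to [letter l] separates 1 from [g]. By [len_step_starts]
    this means that some geodesic word for [g] begins with [l]. *)
Definition starts_with l g : bool := beyond l.1 ((edge_base 1 l)^-1 * g) == l.2.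

Lemma starts_with1 l : starts_with l 1 = false.
Proof. by rewrite /starts_with beyond_base; case: l.2. Qed.

Lemma starts_withM_neq l g k : k.1 != l.1 ->
  starts_with l (g * letter k) = starts_with l g.
Proof. by move=> kl; rewrite /starts_with mulgA beyondM_neq. Qed.

(** The edge of [k] is dual to the hyperplane of [l], so it is the edge of [l] at 1 moved by an
    element of the link subgroup of [l.1]. The edge of [l] is on the near side for [m], and the move
    does not cross the hyperplane of [m], since [m.1] is not in the link. *)
Lemma starts_with_step l m g k : l.1 != m.1 -> ~~ edge l.1 m.1 ->
  ~~ starts_with l g -> starts_with l (g * letter k) ->
  ~~ starts_with m (g * letter k).
Proof.
move=> lm nlm sg; rewrite {1}/starts_with mulgA beyondM crosses_base.
case: (k.1 =P l.1) => [kl|_] /=; last by rewrite addbF -/(starts_with l g) (negPf sg).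
case: (boolP (inlk _ _)) => [|_]; last by rewrite addbF -/(starts_with l g) (negPf sg).
move=> hc _; rewrite starts_withM_neq ?kl //.
have -> : starts_with m g = starts_with m (edge_base g k).
  by rewrite /edge_base; case: k.2; rewrite // starts_withM_neq ?kl.
rewrite -(mulVKg (edge_base 1 l) (edge_base g k)) {1}/starts_with mulgA.
rewrite (beyondM_lk _ nlm hc) -/(starts_with m _).
by rewrite /edge_base; case: l.2; rewrite ?starts_withM_neq // starts_with1.
Qed.

(** For nonadjacent labels the two half-spaces are disjoint: a path from 1 that enters one of them
    is then outside the other. *)
Lemma starts_with_edge l m g : starts_with l g -> starts_with m g ->
  l.1 != m.1 -> edge l.1 m.1.
Proof.
move=> lg mg lm; apply: contraTT isT => nlm.
have nml : ~~ edge m.1 l.1 by rewrite edge_sym.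
have ml : m.1 != l.1 by rewrite eq_sym.
suff : ~~ (starts_with l g && starts_with m g) by rewrite lg mg.
elim/pres_ind_r: g {lg mg} => [|g k IH]; first by rewrite starts_with1.
apply/andP => -[lgk mgk]; move/negP: IH; apply; apply/andP; split.
  by apply: contraLR mgk => lg; apply: (starts_with_step lm).
by apply: contraLR lgk => mg; apply: (starts_with_step ml).
Qed.

Lemma len_step_starts p l : (len (p * letter l) < len p)%N = starts_with l p^-1.
Proof.
rewrite len_step /starts_with; congr (beyond _ _ == _).
rewrite /edge_base; case: l.2; first by rewrite invg1 mul1g.
by rewrite mul1g invgM.
Qed.

(** Let a geodesic word for a central [z] end with [l], and let [m] be a letter not commuting with
    [l]. Then [z * m] is longer than [z]. It can be shortened at its end by removing [m], and also
    by removing [l] because it equals [m * z]; so [l] and [m] would have adjacent labels. *)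
Lemma raag_centerless : (forall v : D, ~ universal v) -> centerless A.
Proof.
move=> nuniv z zc; apply: contrapT => /eqP z1.
have [w wz sw] := geodesic z; elim/last_ind: w wz sw => [|w l _] wz sw.
  by rewrite -wz eqxx in z1.
have lz : (len (z * letter (linv l)) < len z)%N.
  rewrite -sw size_rcons ltnS -wz pres_rcons letterV mulgK; exact: len_word.
have [u lu nlu] : exists2 u, u != l.1 & ~~ edge l.1 u.
  apply: contrapT => h; apply: (nuniv l.1) => u ul; apply: contrapT => /negP nlu.
  by apply: h; exists u.
(* Here [x == x] is [true], so the second letter is [m]. *)
pose m := (u, true); have nedge x : starts_with (linv l) x -> starts_with (u, x == x) x -> False.
  by move=> s1 s2; have := starts_with_edge s1 s2; rewrite /= eq_sym lu (negPf nlu) => /(_ isT).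
have zm : (len z < len (z * letter m))%N.
  rewrite ltnNge leq_eqVlt negb_or lenM_neq /= len_step_starts; apply/negP.
  by move: lz; rewrite len_step_starts => /nedge; rewrite eqxx.
have : starts_with (linv l) (z * letter m)^-1.
  rewrite -len_step_starts (leq_ltn_trans _ zm) // (zc (letter m)) -mulgA.
  by rewrite (leq_trans (lenM _ _)) // (leq_trans (leq_add (len_letter _) (leqnn _))).
have : starts_with (linv m) (z * letter m)^-1.
  by rewrite -len_step_starts letterV mulgK.
move=> s1 s2; have := starts_with_edge s2 s1; rewrite /= eq_sym lu (negPf nlu).
by move=> /(_ isT).
Qed.

End RaagCenter.

(** * The distance of a hyperplane from 1 *)

Section Level.
Variable D : sgraph.
Local Notation A := (raag D).
Implicit Types (u v : D) (l m : D * bool) (w : word D) (a g h c p q : A).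

(** The edges dual to the hyperplane of [(a, v)] are those labelled [v] that start at [a * c] with
    [c] in [C_v]; [n] is the length of the farther end of one of them. *)
Let edge_dist a v n : bool :=
  `[< exists2 c, inlk v c & maxn (len (a * c)) (len (a * c * letter (v, true))) = n >].

Let edge_distP a v : exists n, edge_dist a v n.
Proof. by eexists; apply/asboolP; exists 1; first exact: inlk1. Qed.

(* Strictly monotone along chains of nested hyperplanes (level_nested): this is
   the order in which the contraction below erases letters. *)
Definition level a v : nat := ex_minn (edge_distP a v).

Lemma level_le a v c : inlk v c ->
  (level a v <= maxn (len (a * c)%g) (len (a * c * letter (v, true))%g))%N.
Proof.
move=> vc; rewrite /level; case: ex_minnP => n _; apply; apply/asboolP.
by exists c.
Qed.

Lemma levelP a v : exists2 c, inlk v c &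
  level a v = maxn (len (a * c)) (len (a * c * letter (v, true))).
Proof. by rewrite /level; case: ex_minnP => n /asboolP[c vc <-] _; exists c. Qed.

Lemma level_gt0 a v : (0 < level a v)%N.
Proof.
have [c _ ->] := levelP a v; have := lenM_neq (a * c) (v, true).
by case: (len (a * c)) => [|n]; case: (len _) => [|m]; rewrite ?maxn0 ?max0n ?leq_max.
Qed.

Lemma levelMr a v c : inlk v c -> level (a * c) v = level a v.
Proof.
move=> vc; apply/eqP; rewrite eqn_leq; apply/andP; split.
  have [d vd ->] := levelP a v.
  have -> : a * d = a * c * (c^-1 * d) by rewrite -mulgA mulVKg.
  by apply: level_le; rewrite inlkMl ?inlkV.
by have [d vd ->] := levelP (a * c) v; rewrite -mulgA; apply: level_le; apply: inlkM.
Qed.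

Lemma edge_baseM p l c : inlk l.1 c -> edge_base p l * c = edge_base (p * c) l.
Proof.
move=> lc; rewrite /edge_base; case: l.2; rewrite // -!mulgA; congr (_ * _).
exact/esym/(inlkC lc).
Qed.

Lemma edge_base_len p l : maxn (len (edge_base p l))
  (len (edge_base p l * letter (l.1, true))) = maxn (len p) (len (p * letter l)).
Proof.
case: l => v [] //=; rewrite /edge_base /= maxnC.
by rewrite -[(v, true)]/(linv (v, false)) letterV mulgK.
Qed.

Lemma level_edge p l : (level (edge_base p l) l.1 <= maxn (len p) (len (p * letter l)%g))%N.
Proof.
by rewrite -edge_base_len -{2 3}(mulg1 (edge_base p l)) level_le ?inlk1.
Qed.

Lemma level_edgeP p l : exists2 c, inlk l.1 c & level (edge_base p l) l.1
  = maxn (len (p * c)) (len (p * c * letter l)).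
Proof.
have [c lc ->] := levelP (edge_base p l) l.1; exists c => //.
by rewrite edge_baseM // edge_base_len.
Qed.

(** Replace the edge of [m] by one dual to the same hyperplane and realizing its level. Its start is
    still beyond the hyperplane of [l], since the move crosses no hyperplane labelled [l.1]. A
    geodesic from 1 to that start crosses the hyperplane of [l] at an edge both of whose ends are
    shorter than the level. *)
Lemma level_nested p l q m : ~~ edge m.1 l.1 ->
  (len p < len (p * letter l))%N -> (len q < len (q * letter m))%N ->
  beyond l.1 ((edge_base p l)^-1 * q) = l.2 ->
  (level (edge_base p l) l.1 < level (edge_base q m) m.1)%N.
Proof.
move=> nml pl qm bq; have [c mc ->] := level_edgeP q m.
set v := l.1 in bq nml *; set a := edge_base p l in bq *.
(* Whether an edge leads away from 1 depends only on its hyperplane and direction. *)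
have qcm : (len (q * c) < len (q * c * letter m))%N.
  by rewrite len_step_gt -edge_baseM // invgM beyond_lkM ?inlkV // -len_step_gt.
have [w wq sw] := geodesic (q * c).
have bqc : beyond v (a^-1 * (q * c)) = l.2 by rewrite mulgA (beyondM_lk _ nml mc).
have [|w1 [k [w2 [ew + _]]]] := @last_crossing _ v a 1 w.
  by rewrite mulg1 mul1g wq bqc -len_step_gt.
rewrite !mul1g crosses_base => /andP[/eqP kv ak].
rewrite (maxn_idPr (ltnW qcm)) (leq_ltn_trans _ qcm) //.
rewrite -(levelMr _ ak) mulVKg -kv.
apply: leq_trans (level_edge _ _) _; rewrite -sw ew -pres_rcons.
rewrite geq_max size_cat /= addnS !(leq_trans (len_word _)) // ?size_rcons ?ltnS ?leq_addr //.
by rewrite leqW ?leq_addr.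
Qed.

End Level.
Arguments inlk {D} v g%_g.
Arguments beyond {D} v g%_g.
Arguments edge_base {D} p%_g l.
Arguments level {D} a%_g v.
Arguments starts_with {D} l g%_g.
Arguments crosses {D} v p%_g l.

(** * Points of the cubical complex *)

Section SalvettiPoints.
Local Open Scope ring_scope.
Variables (R : realType) (D : sgraph).
Local Notation A := (raag D).
Implicit Types (u v : D) (l m : D * bool) (a g h c p q : A).
Implicit Types (e : D -> bool) (t : D -> R) (x : A * D -> R).

(* The coordinates of the point of the cube with corner g and edges (v, e v)
   lying at distance t v along each of them: the coordinate at (a, v) is the
   position relative to the hyperplane dual to the edge (a, a v). *)
Definition cube_point g e t : A * D -> R := fun i =>
  (1 - t i.2) * (beyond i.2 (i.1^-1 * g))%:R
  + t i.2 * (beyond i.2 (i.1^-1 * (g * letter (i.2, e i.2))))%:R.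

Definition clique_supp t := forall u v, u != v -> t u != 0 -> t v != 0 -> edge u v.
Definition in_unit t := forall v, 0 <= t v <= 1.

Definition is_point x := exists g e t, [/\ in_unit t, clique_supp t & x = cube_point g e t].

Lemma point_translate h g e t i :
  cube_point (h * g)%g e t i = cube_point g e t ((h^-1 * i.1)%g, i.2).
Proof. by rewrite /cube_point /= invgM invgK !mulgA. Qed.

Lemma point_move g l e t (i : A * D) : (forall u, t u != 0 -> edge u l.1) ->
  cube_point (g * letter l)%g e t i =
    if i.2 == l.1 then (beyond i.2 (i.1^-1 * (g * letter l)))%:R else cube_point g e t i.
Proof.
move=> tl; rewrite /cube_point; case: eqP => [il|/eqP il].
  have -> : t i.2 = 0.
    by apply: contraTeq isT => /tl; rewrite il edge_irr.
  by rewrite subr0 mul1r mul0r addr0.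
rewrite (mulgA _ g) beyondM_neq 1?eq_sym //; congr (_ + _).
have [->|ti] := eqVneq (t i.2) 0; first by rewrite !mul0r.
have /= li := letterC (l := (i.2, e i.2)) (m := l) (tl _ ti).
by rewrite -(mulgA g) -li !mulgA beyondM_neq // eq_sym.
Qed.

Lemma eq_point g e e' t t' : t =1 t' -> (forall v, t v != 0 -> e v = e' v) ->
  cube_point g e t = cube_point g e' t'.
Proof.
move=> tt ee; apply/funext => -[a v]; rewrite /cube_point /= -tt.
by have [->|/ee ->//] := eqVneq (t v) 0; rewrite !mul0r.
Qed.

(** This is the same point described from the other end of the edge [v]; coordinates with other
    labels do not change because [v] commutes with the rest of the support. *)
Lemma point_flip g e t v : clique_supp t -> t v != 0 ->
  cube_point g e t = cube_point (g * letter (v, e v))%g [eta e with v |-> ~~ e v]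
                      [eta t with v |-> 1 - t v].
Proof.
move=> tC tv; apply/funext => -[a u]; rewrite {2}/cube_point /=.
have [->|uv] := eqVneq u v.
  rewrite -[(v, ~~ e v)]/(linv (v, e v)) letterV mulgK /cube_point /=; ring.
rewrite (mulgA _ g) beyondM_neq 1?eq_sym // /cube_point /=; congr (_ + _).
have [->|tu] := eqVneq (t u) 0; first by rewrite !mul0r.
have /= li := letterC (l := (u, e u)) (m := (v, e v)) (tC _ _ uv tu tv).
by rewrite -(mulgA g) -li !mulgA (@beyondM_neq _ _ _ (v, _)) //= eq_sym.
Qed.

Lemma in_unit_flip t v : in_unit t -> in_unit [eta t with v |-> 1 - t v].
Proof.
move=> t01 u /=; have := t01 u; have := t01 v.
by case: eqP => // _ /andP[h1 h2] _; rewrite subr_ge0 h2 lerBlDr lerDl.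
Qed.

Lemma clique_flip t v r : clique_supp t -> t v != 0 ->
  clique_supp [eta t with v |-> r].
Proof.
move=> tC tv u w /=; case: (eqVneq u v) => [->|uv]; case: (eqVneq w v) => [->|wv].
- by [].
- by move=> _ _; apply: tC; rewrite // eq_sym.
- by move=> _ tu _; apply: tC.
- exact: tC.
Qed.

Definition corner_point g t := cube_point g (fun=> true) t.

Lemma corner_pointE g t a v : corner_point g t (a, v) =
  if inlk v (a^-1 * g) then t v else (beyond v (a^-1 * g))%:R.
Proof.
rewrite /corner_point /cube_point /= mulgA beyond_letter.
case E: (inlk _ _); rewrite ?orbF; last by ring.
by rewrite (beyond_lk E) /=; ring.
Qed.

Definition in_halfopen t := forall v, 0 <= t v < 1.

(** A normal form: flip the edges with [t v = 1] and the negative edges of the support. Each flip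
    leaves fewer of them. *)
Lemma is_point_corner x : is_point x ->
  exists g t, [/\ in_halfopen t, clique_supp t & x = corner_point g t].
Proof.
move=> [g [e [t [t01 tC ->]]]].
pose bad e t := [pred v | (t v == 1) || (t v != 0) && ~~ e v].
have [n] := ubnP #|bad e t|; elim: n => // n IH in g e t t01 tC *.
rewrite ltnS => hn; have [v bv|b0] := pickP (bad e t); last first.
  exists g, t; split=> //.
    move=> v; have /andP[-> h] := t01 v; rewrite lt_neqAle h.
    by have := b0 v; rewrite /= => /negbT; rewrite negb_or => /andP[->].
  apply: eq_point => // v tv; have := b0 v; rewrite /= tv => /negbT.
  by rewrite negb_or negbK => /andP[_ ->].
have tv : t v != 0.
  by move: bv; rewrite /= => /orP[/eqP->|/andP[]//]; rewrite oner_eq0.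
rewrite (point_flip _ _ tC tv).
apply: IH; [exact: in_unit_flip|exact: clique_flip|].
apply: leq_trans hn; apply: proper_card; apply/properP; split.
  apply/fintype.subsetP => u; rewrite !inE /=; case: (eqVneq u v) => [->|//] _.
  exact: bv.
exists v => //; rewrite inE /= eqxx negbK; move: bv => /= /orP[/eqP ->|/andP[_ /negPf ->]].
  by rewrite subrr eqxx orbF eq_sym oner_eq0.
by rewrite andbF orbF; move: tv; apply: contra_neqN => /eqP h; lra.
Qed.

(** As [t] stays below 1, a coordinate is 1 exactly when [g] is beyond the hyperplane, so
    [beyond_inj] recovers [g]; then [t v] is the coordinate at [(g, v)]. *)
Lemma corner_point_inj g g' t t' : in_halfopen t -> in_halfopen t' ->
  corner_point g t = corner_point g' t' -> g = g' /\ t =1 t'.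
Proof.
move=> th th' e.
have bE k s v a : in_halfopen s -> (corner_point k s (a, v) == 1) = beyond v (a^-1 * k).
  move=> /(_ v) sh; rewrite corner_pointE; case E: (inlk _ _).
    by rewrite (beyond_lk E); apply/negbTE; rewrite lt_eqF //; case/andP: sh.
  by case: beyond; rewrite ?eqxx // eq_sym oner_eq0.
have gg : g = g'.
  by apply: beyond_inj => v a; rewrite -(invgK a) -(bE _ t) // e bE.
split=> // v; have := congr1 (fun f => f (g, v)) e.
by rewrite -gg !corner_pointE mulVg inlk1.
Qed.

Lemma point_unit g e t i : in_unit t -> 0 <= cube_point g e t i <= 1.
Proof.
move=> /(_ i.2) /andP[t0 t1]; rewrite /cube_point.
by case: beyond; case: beyond; rewrite ?mulr1 ?mulr0 ?addr0 ?add0r; apply/andP; split; lra.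
Qed.

(** Flipping an edge of the support that leads towards 1 shortens the corner, so the descent stops
    at the corner nearest to 1. *)
Lemma is_point_near x : is_point x -> exists g e t,
  [/\ in_unit t, clique_supp t, x = cube_point g e t &
      forall v, t v != 0 -> (len g < len (g * letter (v, e v)))%N].
Proof.
move=> [g [e [t [t01 tC ->]]]].
have [n] := ubnP (len g); elim: n => // n IH in g e t t01 tC *.
rewrite ltnS => hn.
pose bad v := (t v != 0) && (len (g * letter (v, e v)) < len g)%N.
have [v /andP[tv lv]|b0] := pickP bad; last first.
  exists g, e, t; split=> // v tv; have := b0 v; rewrite /bad tv /= => /negbT.
  by rewrite -leqNgt [(_ <= _)%N]leq_eqVlt eq_sym (negPf (lenM_neq _ _)).
rewrite (point_flip _ _ tC tv).
apply: IH; [exact: in_unit_flip|exact: clique_flip|].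
exact: leq_trans lv hn.
Qed.

End SalvettiPoints.

(** * Weighted words and their truncation *)

Section WeightedWords.
Local Open Scope ring_scope.
Variables (R : realType) (D : sgraph).
Local Notation A := (raag D).
Local Notation wword := (seq ((D * bool) * R)).
Implicit Types (u v : D) (l m : D * bool) (a g h c p q : A) (V : wword).
Implicit Types (e : D -> bool) (t : D -> R) (x : A * D -> R).

(* Weighted words are read from right to left: the head is the last letter. *)
Fixpoint wprod V : A := if V is x :: V' then (wprod V' * letter x.1)%g else 1%g.

Definition step p l (i : A * D) : R :=
  (beyond i.2 (i.1^-1 * (p * letter l)))%:R - (beyond i.2 (i.1^-1 * p))%:R.

Fixpoint wpoint V (i : A * D) : R :=
  if V is x :: V' then wpoint V' i + x.2 * step (wprod V') x.1 i
  else (beyond i.2 i.1^-1)%:R.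

(** A letter starts to move only when all earlier letters with nonadjacent label have weight 1; this
    includes letters with its own label. So the letters of fractional weight span a cube. *)
Fixpoint admissible V : bool :=
  if V is x :: V' then
    [&& 0 <= x.2 <= 1, admissible V' &
        (x.2 != 0) ==> all (fun y => ~~ edge y.1.1 x.1.1 ==> (y.2 == 1)) V']
  else true.

Lemma stepE p l i : step p l i =
  if i.2 == l.1 then (beyond i.2 (i.1^-1 * (p * letter l)))%:R
    - (beyond i.2 (i.1^-1 * p))%:R else 0.
Proof.
rewrite /step; case: eqP => // /eqP il.
by rewrite mulgA beyondM_neq ?subrr // eq_sym.
Qed.

Lemma step_lk g l c i : inlk l.1 c -> step (g * c)%g l i = step g l i.
Proof.
move=> lc; rewrite !stepE; case: eqP => // il; rewrite il.
rewrite -(mulgA g) (inlkC lc) // !mulgA.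
by rewrite !(beyondM_lk _ _ lc) // edge_irr.
Qed.

(** Letters of weight 1 are absorbed into the corner [g], and fractional ones enter [t]. The last
    clause is the invariant needed to append a letter labelled [v]: [g] and [wprod V] differ by an
    element of [C_v], so the letter crosses the same hyperplane from either. *)
Lemma admissible_point V : admissible V -> exists g e t,
  [/\ in_unit t, clique_supp t, wpoint V = cube_point g e t &
    forall v, all (fun y => ~~ edge y.1.1 v ==> (y.2 == 1)) V ->
      inlk v (g^-1 * wprod V) /\ forall u, t u != 0 -> edge u v].
Proof.
elim: V => [_|[l r] V IH] /=.
  exists 1%g, xpredT, (fun=> 0); split=> //.
  - by move=> v; rewrite lexx ler01.
  - by move=> u v _; rewrite eqxx.
  - by apply/funext => -[a v]; rewrite /cube_point /= mulg1 subr0 mul1r mul0r addr0.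
  - by move=> v _; rewrite invg1 mul1g inlk1; split=> // u; rewrite eqxx.
case/and3P=> /andP[r0 r1] /IH[g [e [t [t01 tC VE gtl]]]] /implyP rl.
have [r_0|r_n0] := eqVneq r 0.
  exists g, e, t; split=> //.
    by apply/funext => i; rewrite r_0 mul0r addr0 VE.
  move=> v /andP[lv /gtl[gV tv]]; split=> //; rewrite mulgA inlkM // inlk_letter //.
  by rewrite edge_sym; move: lv; rewrite r_0 eq_sym oner_eq0 implybF negbK.
have [gl tl] := gtl _ (rl r_n0).
have wE i : wpoint V i + r * step (wprod V) l i = cube_point g e t i + r * step g l i.
  by rewrite VE -(mulVKg g (wprod V)) step_lk.
have tl0 : t l.1 = 0 by apply: contraTeq isT => /tl; rewrite edge_irr.
have [r_1|r_n1] := eqVneq r 1.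
  exists (g * letter l)%g, e, t; split=> //.
    apply/funext => i; rewrite wE r_1 mul1r (point_move _ _ _ tl) stepE.
    case: eqP => il; last by rewrite addr0.
    by rewrite /cube_point il tl0 subr0 mul1r mul0r addr0 addrC subrK.
  move=> v /andP[lv /gtl[gV tv]]; split=> //.
  by rewrite invgM -mulgA (mulgA g^-1%g) (inlkC gl) // mulKg.
exists g, [eta e with l.1 |-> l.2], [eta t with l.1 |-> r]; split.
- move=> v /=; case: eqP => // _; exact/andP.
- move=> u v /=; case: (eqVneq u l.1) => [->|ul]; case: (eqVneq v l.1) => [->|vl] //.
  + by move=> _ _ /tl; rewrite edge_sym.
  + by move=> _ /tl.
  + exact: tC.
- apply/funext => -[a v]; rewrite wE stepE /cube_point /=; case: (eqVneq v l.1) => [->|_].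
    rewrite -surjective_pairing tl0; ring.
  by rewrite mulr0 addr0.
- move=> v /andP[lv /gtl[gV tv]]; have {}lv : edge l.1 v.
    by move: lv; rewrite implybF negbK.
  split; first by rewrite mulgA inlkM // inlk_letter // edge_sym.
  by move=> u /=; case: (eqVneq u l.1) => [->//|_]; apply: tv.
Qed.

Fixpoint geodesic_word V : bool :=
  if V is x :: V' then
    (len (wprod V') < len (wprod V' * letter x.1))%N && geodesic_word V'
  else true.

(** [c n] is the largest weight left to letters of level [n]; by [c_step] the levels vanish from the
    top down. *)
Variable c : nat -> R.
Hypothesis c01 : forall n, 0 <= c n <= 1.
Hypothesis c_step : forall i j, (i < j)%N -> c j != 0 -> c i = 1.

Fixpoint truncate_word V : wword :=
  if V is x :: V' then
    (x.1, Num.min x.2 (c (level (edge_base (wprod V') x.1) x.1.1))) :: truncate_word V'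
  else [::].

Lemma wprod_truncate V : wprod (truncate_word V) = wprod V.
Proof. by elim: V => //= x V ->. Qed.

(** The vertex 1 has coordinate [beyond i.2 i.1^-1], and that of [x] is brought to within [c] of it.
    In this form continuity can be checked on each coordinate. *)
Definition truncate x : A * D -> R := fun i =>
  if beyond i.2 i.1^-1 then Num.max (x i) (1 - c (level i.1 i.2))
  else Num.min (x i) (c (level i.1 i.2)).

Lemma wpoint_truncate V : geodesic_word V -> admissible V ->
  wpoint (truncate_word V) = truncate (wpoint V).
Proof.
move=> gV aV; apply/funext => -[a v].
pose b := beyond v a^-1; pose s := c (level a v).
have [s0 s1] : 0 <= s /\ s <= 1 by have /andP := c01 (level a v).
(* A word that always leads away from 1 crosses the hyperplane of [(a, v)] either never or once,
   then with some weight [r]. *)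
suff [[bV e1 e2]|[bV [r [/andP[r0 r1] e1 e2]]]] :
    [/\ beyond v (a^-1 * wprod V) = b, wpoint V (a, v) = b%:R
      & wpoint (truncate_word V) (a, v) = b%:R] \/
    beyond v (a^-1 * wprod V) = ~~ b /\ exists r, [/\ 0 <= r <= 1,
      wpoint V (a, v) = b%:R + r * ((~~ b)%:R - b%:R)
      & wpoint (truncate_word V) (a, v) = b%:R + Num.min r s * ((~~ b)%:R - b%:R)].
- rewrite /truncate e1 e2 /= -/b -/s; case: (b) => /=.
    by rewrite max_l // gerBl.
  by rewrite min_l.
- rewrite /truncate e1 e2 /= -/b -/s; case: (b) => /=.
    by rewrite sub0r !mulrN1 -[LHS]opprK; case: (leP r s) => h;
      case: (leP (1 - r) (1 - s)) => h'; lra.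
  by rewrite subr0 !mulr1 !add0r.
elim: V gV aV => [_ _|[l r] V IH] /=; first by left; rewrite mulg1.
move=> /andP[lV /IH{}IH] /and3P[/andP[r0 r1] /IH{}IH _].
rewrite wprod_truncate mulgA beyondM crosses_base stepE /=.
case: (eqVneq v l.1) => [vl|vl]; last first.
  rewrite /= addbF !mulr0 !addr0.
  by case: IH => [[]|[]]; [left|right].
rewrite /= -vl.
case: (boolP (inlk v _)) => /= [va|va]; last first.
  have -> : beyond v (a^-1 * (wprod V * letter l)) = beyond v (a^-1 * wprod V).
    by rewrite mulgA beyondM crosses_base (negPf va) andbF addbF.
  by rewrite addbF subrr !mulr0 !addr0.
set o := edge_base (wprod V) l in lV va *.
have bb : beyond v o^-1 = b by rewrite -(beyond_lkM o^-1%g va) mulgK.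
have bV : beyond v (a^-1 * wprod V) = b.
  rewrite -(mulVKg o (wprod V)) mulgA (beyond_lkM _ va) vl beyond_base.
  by move: lV; rewrite len_step_gt -/o -vl bb; case: (b); case: l.2.
case: IH => [[_ e1 e2]|[bV']]; last by move: bV'; rewrite bV; case: (b).
right; split; first by rewrite bV addbT.
exists r; split; first exact/andP.
  by rewrite e1 mulgA beyondM crosses_base -vl eqxx va bV addbT.
rewrite e2 mulgA beyondM crosses_base -vl eqxx va bV addbT.
by rewrite /s -(levelMr a va) mulVKg.
Qed.

Lemma wprod_cat V1 V2 : wprod (V1 ++ V2) = (wprod V2 * wprod V1)%g.
Proof. by elim: V1 => [|y V1 IH] /=; rewrite ?mulg1 // IH mulgA. Qed.

Lemma len_wprod V : (len (wprod V) <= size V)%N.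
Proof.
elim: V => [|y V IH] /=; first exact: (@len_word D [::]).
by rewrite (leq_trans (lenM _ _)) // -addn1 leq_add // len_letter.
Qed.

Lemma geodesic_word_len V1 V2 : geodesic_word (V1 ++ V2) ->
  (size V1 + len (wprod V2) <= len (wprod (V1 ++ V2)))%N.
Proof.
elim: V1 => //= y V1 IH /andP[lV /IH h].
by rewrite addSn; apply: leq_ltn_trans h lV.
Qed.

(** A geodesic does not cross back: the letters after [y] show that the end of its edge is nearer to
    the endpoint [q] than its start, and [len_step] applies with [q] as origin. *)
Lemma geodesic_word_beyond V1 (y : (D * bool) * R) V2 : geodesic_word (V1 ++ y :: V2) ->
  beyond y.1.1 ((edge_base (wprod V2) y.1)^-1 * wprod (V1 ++ y :: V2)) = y.1.2.
Proof.
move=> gV; have h1 := geodesic_word_len gV.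
have h2 : (len (wprod V2) < len (wprod (y :: V2)))%N.
  by elim: (V1) gV => [/andP[]//|z V1' IH /andP[_ /IH]].
set q := wprod (V1 ++ _) in h1 *; set p := wprod V2 in h2 *.
have qE : q = (p * letter y.1 * wprod V1)%g by rewrite /q wprod_cat.
have -> : ((edge_base p y.1)^-1 * q = (edge_base (q^-1 * p) y.1)^-1)%g.
  rewrite -(invgK q) -invgM invgK; congr (_^-1)%g.
  by rewrite /edge_base; case: y.1.2; rewrite // mulgA.
apply/eqP; rewrite -len_step -mulgA {1}qE invgM mulgVK lenV.
rewrite (leq_ltn_trans (len_wprod V1)) //.
have := lenM p (p^-1 * q)%g; rewrite mulVKg -[len (p^-1 * q)]lenV invgM invgK => h3.
rewrite -(ltn_add2r (len p)) addnC.
apply: leq_trans (leq_trans h1 _); last by rewrite [X in (_ <= X)%N]addnC.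
by rewrite addnC ltn_add2l.
Qed.

(** If [l] keeps a nonzero weight, then [c] does not vanish at its level. An earlier letter with
    nonadjacent label has smaller level by [level_nested], so by [c_step] it keeps its weight 1. *)
Lemma truncate_word_admissible V : geodesic_word V -> admissible V ->
  admissible (truncate_word V).
Proof.
elim: V => // -[l r] V IH /= /andP[lV gV] /and3P[/andP[r0 r1] aV /implyP rV].
have [s0 s1] := andP (c01 (level (edge_base (wprod V) l) l.1)).
apply/and3P; split; [|exact: IH|].
  by rewrite le_min r0 s0 ge_min r1.
apply/implyP => rs.
have {rV}rV : all (fun y => ~~ edge y.1.1 l.1 ==> (y.2 == 1)) V.
  by apply: rV; apply: contra_neq rs => ->; rewrite min_l.
have {r0 r1 aV} cs : c (level (edge_base (wprod V) l) l.1) != 0.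
  by apply: contra_neq rs => ->; rewrite min_r.
suff sub V1 V2 : V = V1 ++ V2 ->
    all (fun y => ~~ edge y.1.1 l.1 ==> (y.2 == 1)) (truncate_word V2) by exact: (sub [::]).
elim: V2 V1 => [|[m q] V2 IH2] V1 //= VE.
rewrite (IH2 (rcons V1 (m, q))) ?cat_rcons // andbT; apply/implyP => nml.
have /allP/(_ (m, q)) := rV; rewrite VE mem_cat inE eqxx orbT => /(_ isT) /=.
rewrite nml /= => /eqP ->.
have nV : geodesic_word ((m, q) :: V2).
  by move: gV; rewrite VE; elim: (V1) => //= y V' IHV /andP[_ /IHV].
have -> : c (level (edge_base (wprod V2) m) m.1) = 1.
  apply: c_step cs; apply: level_nested => //; first by rewrite edge_sym.
    by case/andP: nV.
  by rewrite VE; apply: (@geodesic_word_beyond _ (m, q)); rewrite -VE.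
by rewrite minxx.
Qed.

Lemma geodesic_word_of g : exists V, [/\ wprod V = g, geodesic_word V,
  all (fun y => y.2 == 1) V & admissible V].
Proof.
have [n] := ubnP (len g); elim: n => // n IH in g *; rewrite ltnS => gn.
have [w wg sw] := geodesic g; case/lastP: w => [|w l] in wg sw.
  by exists [::]; split=> //; rewrite -wg.
have eg : g = (word_of w * letter l)%g by rewrite -pres_rcons.
have lw : (len (word_of w : A) < len g)%N.
  by rewrite -sw size_rcons ltnS; apply: len_word.
have [V [VE gV V1 aV]] := IH _ (leq_trans lw gn).
exists ((l, 1) :: V); split=> /=; rewrite ?VE ?eqxx -?eg ?lw ?ler01 ?lexx ?aV //=.
by apply/implyP => _; apply: sub_all V1 => y ->; rewrite implybT.
Qed.

Lemma wpoint_full V i : all (fun y => y.2 == 1) V ->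
  wpoint V i = (beyond i.2 (i.1^-1 * wprod V))%:R.
Proof.
elim: V => [_|x V IH] /=; first by rewrite mulg1.
by case/andP=> /eqP -> /IH ->; rewrite mul1r /step addrC subrK.
Qed.

(** Take the corner nearest to 1, a geodesic word for it with weights 1, and then the edges of the
    support with their weights. Each of these still leads away from 1 because the others commute
    with it. *)
Lemma is_point_word x : is_point x -> exists V,
  [/\ geodesic_word V, admissible V & x = wpoint V].
Proof.
move=> /is_point_near[g [e [t [t01 tC -> lt]]]].
have [V0 [VE gV V1 aV]] := geodesic_word_of g.
suff key (s : seq D) : uniq s -> (forall u, u \in s -> t u != 0) -> exists k V,
    [/\ wprod V = (g * k)%g, geodesic_word V, admissible V,
        wpoint V = cube_point g e (fun u => if u \in s then t u else 0) &
        forall v, (forall u, u \in s -> edge u v) ->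
          inlk v k /\ all (fun y => ~~ edge y.1.1 v ==> (y.2 == 1)) V].
  have [||k [V [_ gV' aV' VE' _]]] := key [seq u <- enum D | t u != 0].
  - exact/filter_uniq/enum_uniq.
  - by move=> u; rewrite mem_filter => /andP[].
  exists V; split=> //; rewrite VE'; apply: eq_point => // u.
  by rewrite mem_filter mem_enum andbT; case: eqP.
elim: s => [_ _|u s IH /= /andP[us su] ts].
  exists 1%g, V0; split=> //; first by rewrite mulg1.
    apply/funext => i; rewrite wpoint_full // VE /cube_point /=.
    by rewrite subr0 mul1r mul0r addr0.
  move=> v _; split; first exact: inlk1.
  by apply: sub_all V1 => y /= ->; rewrite implybT.
have [//|v vs|k [V [kE gV' aV' VE' Vl]]] := IH; first by apply: ts; rewrite inE vs orbT.
have tu : t u != 0 by apply: ts; rewrite mem_head.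
have [uk Vu] : inlk u k /\ all (fun y => ~~ edge y.1.1 u ==> (y.2 == 1)) V.
  apply: Vl => v vs; apply: tC => //; last by apply: ts; rewrite inE vs orbT.
  by apply: contraNneq us => <-.
exists (k * letter (u, e u))%g, (((u, e u), t u) :: V); split=> /=.
- by rewrite kE mulgA.
- rewrite kE gV' andbT len_step_gt -edge_baseM // invgM beyond_lkM ?inlkV //.
  by rewrite -len_step_gt lt.
- by rewrite t01 aV' Vu implybT.
- apply/funext => -[a v]; rewrite VE' kE step_lk // stepE /cube_point /= inE.
  case: (eqVneq v u) => [->|vu]; last by rewrite mulr0 addr0.
  rewrite (negPf us) /=; ring.
- move=> v uv; have [kv Vv] : inlk v k /\ all (fun y => ~~ edge y.1.1 v ==> (y.2 == 1)) V.
    by apply: Vl => w ws; apply: uv; rewrite inE ws orbT.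
  have {}uv : edge u v by apply: uv; rewrite mem_head.
  by split; [rewrite inlkM ?inlk_letter //= edge_sym | rewrite uv Vv].
Qed.

Lemma truncate_point x : is_point x -> is_point (truncate x).
Proof.
move=> /is_point_word[V [gV aV ->]]; rewrite -wpoint_truncate //.
have [g [e [t [t01 tC -> _]]]] := admissible_point (truncate_word_admissible gV aV).
by exists g, e, t.
Qed.

End WeightedWords.

(** * Open stars of vertices *)

Section Star.
Local Open Scope ring_scope.
Variables (R : realType) (D : sgraph).
Local Notation A := (raag D).
Implicit Types (u v : D) (l m : D * bool) (a g h c p q k : A).
Implicit Types (t z : D -> R) (x : A * D -> R).
Local Notation L v := (letter (v, true) : A).

(** The open star of the vertex [g]: for each label, the point is short of the far ends of the two
    edges with that label at [g]. *)
Definition in_star g x := forall v,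
  x (g, v) < 1 /\ 0 < x ((g * letter (v, false))%g, v).

Lemma starts_with_exists k : k != 1%g -> exists l, starts_with l k.
Proof.
have [[|l w] wk sw] := geodesic k; first by rewrite -wk eqxx.
move=> _; exists l; rewrite -[k]invgK -len_step_starts.
by rewrite -{1}wk pres_cons invgM mulgVK !lenV -sw ltnS len_word.
Qed.

(** [tau k v] says that [k] lies across the edge from 1 to the inverse of [v], and [star k z] that
    [corner_point k z] is in the open star of 1. Such a [k] is the product of the inverses of the
    [v] with [tau k v]; [star_step] removes one factor. *)
Let tau k v := ~~ beyond v (L v * k).
Let star k z := forall v, [/\ 0 <= z v < 1, beyond v k = false &
  tau k v -> inlk v (L v * k) /\ z v != 0].

Let star_step k z v : clique_supp z -> star k z -> tau k v ->
  star (L v * k)%g z /\ forall u, tau (L v * k)%g u = tau k u && (u != v).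
Proof.
move=> zC sk kv; have [zv _ /(_ kv)[vk zv0]] := sk v.
have kE : k = (L v * k * letter (v, false))%g.
  by rewrite (inlkC vk) // -[(v, false)]/(linv (v, true)) letterV mulKg.
have tauE u : tau (L v * k)%g u = tau k u && (u != v).
  rewrite /tau; case: (eqVneq u v) => [->|uv]; rewrite ?andbT ?andbF.
    by rewrite -(inlkC vk (erefl : (v, true).1 = v)) beyond_letter vk orbT.
  by rewrite [in RHS]kE [in RHS]mulgA beyondM_neq // eq_sym.
split=> // u; have [zu ku kuS] := sk u; split=> //.
  case: (eqVneq u v) => [->|uv]; first exact: beyond_lk.
  by move: ku; rewrite {1}kE beyondM_neq // eq_sym.
rewrite tauE => /andP[/kuS[uk zu0] uv]; split=> //.
move: uk; rewrite {1}kE (mulgA (L u)) (@inlkMr _ _ _ (letter (v, false))) //.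
by apply: inlk_letter; apply: zC.
Qed.

Let star_ind (P : A -> Prop) z : clique_supp z -> P 1%g ->
  (forall k v, inlk v (L v * k) -> z v != 0 -> star k z -> tau k v ->
    P (L v * k)%g -> P k) -> forall k, star k z -> P k.
Proof.
move=> zC P1 Pl k; have [n] := ubnP #|tau k|; elim: n => // n IH in k *.
rewrite ltnS => kn sk; have [v kv|k0] := pickP (tau k); last first.
  (* If no [v] satisfies [tau k v] then [k = 1]: a positive first letter contradicts
     [beyond v k = false], and a negative one gives [tau k v]. *)
  have [->//|/starts_with_exists[[v b]]] := eqVneq k 1%g.
  rewrite /starts_with /edge_base; case: b => /=.
    by rewrite invg1 mul1g; have [_ -> _] := sk v.
  by rewrite mul1g -letterV -[linv _]/(v, true) eqbF_neg -/(tau k v) k0.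
have [_ _ /(_ kv)[vk zv]] := sk v.
have [sk' tk'] := star_step zC sk kv.
apply: (Pl k v vk zv sk kv (IH _ _ sk')).
apply: leq_trans kn; apply: proper_card; apply/properP; split.
  by apply/fintype.subsetP => u; rewrite -!topredE /= tk' => /andP[].
by exists v; rewrite -topredE //= tk' eqxx andbF.
Qed.

Let star_lk k z v : clique_supp z -> star k z -> z v != 0 ->
  inlk v k || inlk v (L v * k).
Proof.
move=> zC + zv; move: k; apply: star_ind => // [|k u uk zu sk ku]; first by rewrite inlk1.
case: (eqVneq v u) => [->|vu]; first by rewrite uk orbT.
have uv : edge v u by apply: zC.
rewrite inlkMl ?inlk_letter // mulgA.
have -> : (L v * L u = L u * L v)%g by apply: letterC.
by rewrite -mulgA (@inlkMl _ _ _ (L u)) // inlk_letter.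
Qed.

Let star_uniq k k' z : clique_supp z -> star k z -> star k' z ->
  (forall v, tau k v = tau k' v) -> k = k'.
Proof.
move=> zC sk; move: k sk k'; apply: star_ind => // [|k v vk zv sk kv IH] k' sk' kk'.
  have [->//|/starts_with_exists[[v b]]] := eqVneq k' 1%g.
  rewrite /starts_with /edge_base; case: b => /=.
    by rewrite invg1 mul1g; have [_ -> _] := sk' v.
  rewrite mul1g -letterV -[linv _]/(v, true) eqbF_neg -/(tau k' v) -kk'.
  by rewrite /tau mulg1 beyond_gen.
have kv' : tau k' v by rewrite -kk'.
have [sk1 t1] := star_step zC sk kv; have [sk1' t1'] := star_step zC sk' kv'.
by apply: (@mulgI _ (L v)); apply: IH => // u; rewrite t1 t1' kk'.
Qed.

Let in_star_star g k t : clique_supp t -> in_halfopen t ->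
  in_star g (corner_point k t) -> star (g^-1 * k)%g t.
Proof.
move=> tC th sk v; have [] := sk v; rewrite !corner_pointE.
rewrite -[(v, false)]/(linv (v, true)) letterV invgM invgK -mulgA.
set b := inlk v (g^-1 * k) => h1 h2; split; first exact: th.
  by move: h1; rewrite /b; case: (boolP (inlk _ _)) => [/beyond_lk//|_];
    case: beyond; rewrite // ltxx.
rewrite /tau => /negPf tv; move: h2; rewrite tv.
by case: (inlk _ _); rewrite ?ltxx // => /gt_eqF ->.
Qed.

(** The edges labelled [v] that enter and leave [g] form a segment; the alternative tells to which
    of them the point projects. *)
Lemma in_star_coord g k t v : clique_supp t -> in_halfopen t ->
  in_star g (corner_point k t) ->
  let x := corner_point k t in
  (x (g, v) = t v /\ x ((g * letter (v, false))%g, v) = 1) \/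
  (x (g, v) = 0 /\ x ((g * letter (v, false))%g, v) = t v).
Proof.
move=> tC th sk; have st := in_star_star tC th sk; rewrite /= !corner_pointE.
rewrite -[(v, false)]/(linv (v, true)) letterV invgM invgK -mulgA.
set h := (g^-1 * k)%g in st *; have [tv hv hS] := st v.
case: (boolP (tau h v)) => [ht|]; last first.
  rewrite negbK => bh; left.
  have -> : inlk v (L v * h) = false by apply: contraTF bh => /beyond_lk ->.
  rewrite bh; split=> //; case: (boolP (inlk v h)) => // vh.
  have [-> |tv0] := eqVneq (t v) 0; first by rewrite hv.
  have := star_lk tC st tv0; rewrite (negPf vh) /= => /beyond_lk.
  by rewrite bh.
right; have [vh _] := hS ht; rewrite vh hv; split=> //.
suff -> : inlk v h = false by [].
by apply/negP => hh; move: vh; rewrite inlkMr // inlk_gen.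
Qed.

Lemma in_star_inj g k k' t : clique_supp t -> in_halfopen t ->
  in_star g (corner_point k t) -> in_star g (corner_point k' t) ->
  (forall v, let i := ((g * letter (v, false))%g, v) in
     (corner_point k t i == 1) = (corner_point k' t i == 1)) -> k = k'.
Proof.
move=> tC th sk sk' kk'.
have tauE h v : star (g^-1 * h)%g t -> in_star g (corner_point h t) ->
    tau (g^-1 * h)%g v = (corner_point h t ((g * letter (v, false))%g, v) != 1).
  move=> sh _; rewrite corner_pointE.
  rewrite -[(v, false)]/(linv (v, true)) letterV invgM invgK -mulgA.
  have [/andP[_ tv] hv hS] := sh v; rewrite /tau.
  case: (boolP (inlk _ _)) => [/beyond_lk ->|nl]; first by rewrite lt_eqF.
  by case: beyond; rewrite ?eqxx // eq_sym oner_eq0.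
have st := in_star_star tC th sk; have st' := in_star_star tC th sk'.
apply: (@mulgI _ g^-1%g); apply: (star_uniq tC st st') => v.
by rewrite !tauE // kk'.
Qed.

Lemma in_star_corner g t : in_halfopen t -> in_star g (corner_point g t).
Proof.
move=> th v; have /andP[_ tv] := th v; rewrite !corner_pointE mulVg inlk1; split=> //.
rewrite -[(v, false)]/(linv (v, true)) letterV invgM invgK -mulgA mulVg mulg1.
by rewrite inlk_gen beyond_gen.
Qed.

(** The sum of the two coordinates is [1 + t' v] or [t' v]. If it is within 1/2 of [1 + t v], the
    first case forces [t' v] to be within 1/2 of [t v], and the second excludes it. *)
Lemma in_star_near g k t t' v : in_halfopen t -> in_halfopen t' -> clique_supp t' ->
  in_star g (corner_point k t') ->
  let i := ((g * letter (v, false))%g, v) in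
  `|corner_point k t' (g, v) + corner_point k t' i - (1 + t v)| < 2^-1 ->
  (corner_point k t' i == 1) = (`|t' v - t v| < 2^-1).
Proof.
move=> th th' tC' sk i.
have /andP[t0 t1] := th v; have /andP[t0' t1'] := th' v.
case: (in_star_coord v tC' th' sk) => /= -[-> ->].
  by have -> : t' v + 1 - (1 + t v) = t' v - t v by [ring]; rewrite eqxx => ->.
rewrite lt_eqF // add0r => h; apply/esym/negbTE; rewrite -leNgt.
move: h; rewrite ltr_norml => /andP[h _].
rewrite ler_normr; apply/orP; left; lra.
Qed.

End Star.

(** * The universal cover and its quotient *)

Section Cover.
Local Open Scope classical_set_scope.
Local Open Scope ring_scope.
Variables (R : realType) (D : sgraph).
Local Notation A := (raag D).
Implicit Types (u v : D) (a g h k : A) (t : D -> R).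

Record ucover := UCover { ucoord : A * D -> R; ucoordP : is_point ucoord }.

HB.instance Definition _ := gen_eqMixin ucover.
HB.instance Definition _ := gen_choiceMixin ucover.

Lemma ucover_inj (x y : ucover) : ucoord x = ucoord y -> x = y.
Proof.
case: x y => [x xP] [y yP] /= xy; subst y; congr UCover; exact: Prop_irrelevance.
Qed.

HB.instance Definition _ := Topological.copy ucover
  (sup_topology (fun i : A * D =>
    Topological.class (initial_topology (fun x : ucover => ucoord x i)))).

Lemma ucoord_continuous i : continuous (fun x : ucover => ucoord x i).
Proof.
move=> x; have /cvg_sup/(_ i) h : x --> x by apply: cvg_id.
exact: (cvg_trans (cvg_app _ h) (@initial_continuous _ _ (fun x : ucover => ucoord x i) x)).
Qed.

Lemma continuous_to_ucover (T : topologicalType) (f : T -> ucover) :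
  (forall i, continuous (fun x => ucoord (f x) i)) -> continuous f.
Proof.
move=> fc x; apply/cvg_sup => i.
exact: (@continuous_comp_initial _ _ _ (fun x : ucover => ucoord x i) f (fc i) x).
Qed.

(* The largest weight that a letter of level n keeps at time s.  At each time
   at most one level has a value other than 0 and 1. *)
Definition schedule (s : R) (n : nat) : R :=
  Num.max 0 (Num.min 1 ((n.+1)%:R * (1 - n%:R * s))).

Lemma schedule01 s n : 0 <= schedule s n <= 1.
Proof. by rewrite le_max lexx /= ge_max ler01 ge_min lexx. Qed.

(** For positive [n], level [n] decreases from 1 to 0 while [s] runs from [1/(n+1)] to [1/n]. These
    intervals meet only at their ends, and higher levels come first. *)
Lemma schedule_step s i j : (i < j)%N -> schedule s j != 0 -> schedule s i = 1.
Proof.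
move=> ij sj; have js : j%:R * s < 1.
  rewrite ltNge; apply: contra_neqN sj => h; rewrite /schedule max_l //.
  by rewrite ge_min; apply/orP; right; rewrite pmulr_rle0 ?ltr0Sn // subr_le0.
have is' : i.+1%:R * s <= 1.
  have [s0|s0] := leP s 0.
    by rewrite (le_trans _ ler01) // mulr_ge0_le0.
  by rewrite (le_trans _ (ltW js)) // ler_pM2r // ler_nat.
rewrite /schedule (_ : Num.min _ _ = 1) ?max_r //; apply/min_idPl.
have -> : i.+1%:R * (1 - i%:R * s) = i.+1%:R - i%:R * (i.+1%:R * s) by ring.
have : i%:R * (i.+1%:R * s) <= i%:R :> R by rewrite ler_piMr.
by rewrite -natr1; lra.
Qed.

Lemma schedule0 n : schedule 0 n = 1.
Proof.
rewrite /schedule mulr0 subr0 mulr1 min_l ?max_r //.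
by rewrite (ler_nat R 1).
Qed.

Lemma schedule1 n : (0 < n)%N -> schedule 1 n = 0.
Proof.
move=> n0; rewrite /schedule max_l // ge_min; apply/orP; right.
by rewrite mulr1 pmulr_rle0 ?ltr0Sn // subr_le0 (ler_nat R 1).
Qed.

Definition ucontract (y : ucover * R) : ucover :=
  UCover (truncate_point (schedule01 y.2) (@schedule_step y.2) (ucoordP y.1)).

Let cts_max (T : topologicalType) (f g : T -> R) : continuous f -> continuous g ->
  continuous (fun x => Num.max (f x) (g x)).
Proof. by move=> fc gc x; apply: (@continuous_max R T f g x (fc x) (gc x)). Qed.

Let cts_min (T : topologicalType) (f g : T -> R) : continuous f -> continuous g ->
  continuous (fun x => Num.min (f x) (g x)).
Proof. by move=> fc gc x; apply: (@continuous_min R T f g x (fc x) (gc x)). Qed.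

Let cts_sub (T : topologicalType) (f g : T -> R) : continuous f -> continuous g ->
  continuous (fun x => f x - g x).
Proof. by move=> fc gc x; apply: (@cvgB _ R T _ _ f g _ _ (fc x) (gc x)). Qed.

Let cts_add (T : topologicalType) (f g : T -> R) : continuous f -> continuous g ->
  continuous (fun x => f x + g x).
Proof. by move=> fc gc x; apply: (@cvgD _ R T _ _ f g _ _ (fc x) (gc x)). Qed.

Let cts_mul (T : topologicalType) (f g : T -> R) : continuous f -> continuous g ->
  continuous (fun x => f x * g x).
Proof. by move=> fc gc x; apply: (@cvgM R T _ _ f g _ _ (fc x) (gc x)). Qed.

Let cts_cst (T : topologicalType) (r : R) : continuous (fun _ : T => r).
Proof. exact: cst_continuous. Qed.

Let cts_comp (S T : topologicalType) (f : S -> T) (g : T -> R) :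
  continuous f -> continuous g -> continuous (fun x => g (f x)).
Proof. by move=> fc gc x; apply: (continuous_comp (fc x) (gc (f x))). Qed.

Lemma schedule_continuous n : continuous (schedule^~ n).
Proof.
apply: (@cts_max R) => //; apply: (@cts_min R) => //.
apply: (@cts_mul R) => //; apply: (@cts_sub R) => //; apply: (@cts_mul R) => // s.
exact: cvg_id.
Qed.

Lemma ucontract_continuous : continuous ucontract.
Proof.
have fstc i : continuous (fun y : ucover * R => ucoord y.1 i).
  apply: (@cts_comp (ucover * R)%type ucover fst (fun x => ucoord x i)).
    by move=> y; apply: cvg_fst.
  exact: ucoord_continuous.
have sndc n : continuous (fun y : ucover * R => schedule y.2 n).
  apply: (@cts_comp (ucover * R)%type R snd (schedule^~ n)).
    by move=> y; apply: cvg_snd.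
  exact: schedule_continuous.
apply: continuous_to_ucover => -[a v]; rewrite /= /truncate /=.
case: (beyond v a^-1).
  by apply: (@cts_max (ucover * R)%type) => //; apply: (@cts_sub (ucover * R)%type).
exact: (@cts_min (ucover * R)%type).
Qed.

Lemma ucontract0 x : ucontract (x, 0) = x.
Proof.
apply: ucover_inj; apply/funext => -[a v]; rewrite /= /truncate /= schedule0 subrr.
have [g [e [t [t01 _ xE]]]] := ucoordP x.
have /andP[x0 x1] := point_unit g e (a, v) t01; rewrite -xE in x0 x1.
by case: beyond; [rewrite max_l | rewrite min_l].
Qed.

Lemma base_subproof : is_point (corner_point (1%g : A) (fun=> 0 : R)).
Proof.
exists 1%g, xpredT, (fun=> 0); split=> //; first by move=> v; rewrite lexx ler01.
by move=> u v _; rewrite eqxx.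
Qed.

Definition ubase : ucover := UCover base_subproof.

Lemma ucontract1 x : ucontract (x, 1) = ubase.
Proof.
apply: ucover_inj; apply/funext => -[a v].
rewrite /= /truncate /= (schedule1 (level_gt0 a v)) subr0 corner_pointE mulg1.
have [g [e [t [t01 _ xE]]]] := ucoordP x.
have /andP[x0 x1] := point_unit g e (a, v) t01; rewrite -xE in x0 x1.
case: (boolP (inlk _ _)) => [/beyond_lk ->|_]; first by rewrite min_r.
by case: beyond; [rewrite max_r | rewrite min_r].
Qed.

Lemma ucover_contractible : contractible R ucover.
Proof.
exists ubase, ucontract; split; [|exact: ucontract0|exact: ucontract1].
exact/continuous_subspaceT/ucontract_continuous.
Qed.

Lemma translate_subproof g (x : ucover) :
  is_point (fun i : A * D => ucoord x ((g^-1 * i.1)%g, i.2)).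
Proof.
have [h [e [t [t01 tC xE]]]] := ucoordP x; exists (g * h)%g, e, t; split=> //.
by apply/funext => i; rewrite xE point_translate.
Qed.

Definition translate g (x : ucover) : ucover := UCover (translate_subproof g x).

Lemma translate1 x : translate 1%g x = x.
Proof.
by apply: ucover_inj; apply/funext => -[a v] /=; rewrite invg1 mul1g.
Qed.

Lemma translateM g h x : translate (g * h)%g x = translate g (translate h x).
Proof.
by apply: ucover_inj; apply/funext => -[a v] /=; rewrite invgM mulgA.
Qed.

Lemma translate_continuous g : continuous (translate g).
Proof.
apply: continuous_to_ucover => i.
exact: (@ucoord_continuous ((g^-1 * i.1)%g, i.2)).
Qed.

Lemma corner_translate g k t i :
  corner_point (g * k)%g t i = corner_point k t ((g^-1 * i.1)%g, i.2).
Proof. exact: point_translate. Qed.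

Lemma ucover_corner (x : ucover) : exists g t,
  [/\ in_halfopen t, clique_supp t & ucoord x = corner_point g t].
Proof. exact/is_point_corner/ucoordP. Qed.

Lemma in_star_nbhs (x : ucover) g t : in_halfopen t -> ucoord x = corner_point g t ->
  \forall y \near x, in_star g (ucoord y).
Proof.
move=> th xE; have xs := in_star_corner g th; rewrite -xE in xs.
apply: (@filter_forall _ _ (fun v (y : ucover) =>
  ucoord y (g, v) < 1 /\ 0 < ucoord y ((g * letter (v, false))%g, v))
  _ (nbhs_filter x)) => v.
have [x1 x0] := xs v.
have h1 : \forall y \near x, ucoord y (g, v) < 1.
  exact: (cvgr_lt _ (@ucoord_continuous (g, v) x) _ x1).
have h2 : \forall y \near x, 0 < ucoord y ((g * letter (v, false))%g, v).
  exact: (cvgr_gt _ (@ucoord_continuous _ x) _ x0).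
exact: filterI.
Qed.

(** [U] lies in the open star of [g], where the sums of [in_star_near] are within 1/2 of their
    values at [x]. A point of [U] and a translate of it in [U] have the same [t'], so they project
    to the same edges at [g], and [in_star_inj] identifies their corners. *)
Lemma translate_covering (x : ucover) : exists2 U, open_nbhs x U &
  forall g, g <> 1%g -> U `&` translate g @` U = set0.
Proof.
have [g [t [th tC xE]]] := ucover_corner x.
pose i v := ((g * letter (v, false))%g, v).
have near : \forall y \near x, in_star g (ucoord y) /\
    forall v, `|ucoord y (g, v) + ucoord y (i v) - (1 + t v)| < 2^-1.
  apply: filterI; first exact: in_star_nbhs th xE.
  apply: (@filter_forall _ _ (fun v (y : ucover) =>
    `|ucoord y (g, v) + ucoord y (i v) - (1 + t v)| < 2^-1)
    _ (nbhs_filter x)) => v.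
  have fc : continuous (fun y => ucoord y (g, v) + ucoord y (i v) - (1 + t v)).
    apply: cts_sub => //.
    by apply: cts_add; apply: (@ucoord_continuous (_, v)).
  apply: (cvgr_lt _ (cvg_norm (fc x))); rewrite xE /i !corner_pointE mulVg inlk1.
  rewrite -[(v, false)]/(linv (v, true)) letterV invgM invgK -mulgA mulVg mulg1.
  by rewrite inlk_gen beyond_gen [t v + _]addrC subrr normr0 invr_gt0 ltr0Sn.
move: near; rewrite /prop_near1 nbhsE => -[U xU UP]; exists U => // h h1.
rewrite -subset0 => y [/UP[ys yt]] [z /UP[zs zt] zy]; apply: h1.
have [k [t' [th' tC' zE]]] := ucover_corner z.
have yE : ucoord y = corner_point (h * k)%g t'.
  by apply/funext => j; rewrite corner_translate -zE -zy.
rewrite zE yE in ys zs yt zt.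
have hk : k = (h * k)%g.
  apply: (in_star_inj tC' th' zs ys) => v /=.
  by rewrite (in_star_near th th' tC' zs) // (in_star_near th th' tC' ys).
by apply: (@mulIg _ k); rewrite mul1g -hk.
Qed.

Definition same_orbit (x y : ucover) : bool := `[< exists g, y = translate g x >].

Let same_orbit_refl : reflexive same_orbit.
Proof. by move=> x; apply/asboolP; exists 1%g; rewrite translate1. Qed.
Let same_orbit_sym : symmetric same_orbit.
Proof.
have sub x y : same_orbit x y -> same_orbit y x.
  move=> /asboolP[g ->]; apply/asboolP; exists g^-1%g.
  by rewrite -translateM mulVg translate1.
by move=> x y; apply/idP/idP; apply: sub.
Qed.
Let same_orbit_trans : transitive same_orbit.
Proof.
move=> y x z /asboolP[g ->] /asboolP[h ->]; apply/asboolP.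
by exists (h * g)%g; rewrite translateM.
Qed.

Canonical same_orbit_equiv :=
  EquivRel same_orbit same_orbit_refl same_orbit_sym same_orbit_trans.

Definition salvetti : topologicalType := quotient_topology {eq_quot same_orbit_equiv}.

Definition orbit_of (x : ucover) : salvetti := \pi_({eq_quot same_orbit_equiv}) x.

Lemma orbit_ofP x y : orbit_of x = orbit_of y <-> exists g, y = translate g x.
Proof. by split=> [/eqmodP/asboolP//|H]; apply/eqmodP/asboolP. Qed.

Lemma orbit_of_surj (p : salvetti) : exists x, orbit_of x = p.
Proof. by exists (repr p); apply: reprK. Qed.

Lemma orbit_of_continuous : continuous orbit_of.
Proof. exact: pi_continuous. Qed.

Lemma classifying_salvetti : classifying_space R A salvetti.
Proof.
exists ucover, translate, orbit_of; split; first exact: ucover_contractible.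
split; split.
- exact: translate1.
- exact: translateM.
- exact: translate_continuous.
- exact: translate_covering.
- exact: orbit_of_surj.
- exact: orbit_ofP.
- by [].
Qed.

End Cover.

(** * Cell structure of the quotient *)

Section SalvettiCW.
Local Open Scope classical_set_scope.
Local Open Scope ring_scope.
Variables (R : realType) (D : sgraph).
Local Notation A := (raag D).
Local Notation ucover := (ucover R D).
Local Notation salvetti := (salvetti R D).
Implicit Types (u v : D) (a g h k : A) (t : D -> R).

Let frac_ex (x : ucover) : exists t g,
  [/\ in_halfopen t, clique_supp t & ucoord x = corner_point g t].
Proof. by have [g [t tP]] := ucover_corner x; exists t, g. Qed.

(** A complete invariant of the orbit of [x], by [orbit_of_frac] and [frac_orbit_of]. *)
Definition frac (x : ucover) : D -> R := proj1_sig (cid (frac_ex x)).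

Lemma frac_spec x : exists g,
  [/\ in_halfopen (frac x), clique_supp (frac x) & ucoord x = corner_point g (frac x)].
Proof. exact: proj2_sig (cid (frac_ex x)). Qed.

Lemma fracE x g t : in_halfopen t -> ucoord x = corner_point g t -> frac x = t.
Proof.
move=> th xE; have [k [fh _ xE']] := frac_spec x.
by have [_ /funext] := corner_point_inj fh th (etrans (esym xE') xE).
Qed.

Lemma frac_translate g x : frac (translate g x) = frac x.
Proof.
have [k [fh _ xE]] := frac_spec x; apply: (fracE (g := (g * k)%g) fh).
by apply/funext => i /=; rewrite corner_translate xE.
Qed.

Lemma orbit_of_frac x y : frac x = frac y -> orbit_of x = orbit_of y.
Proof.
move=> xy; have [k [_ _ xE]] := frac_spec x; have [k' [_ _ yE]] := frac_spec y.
apply/orbit_ofP; exists (k' * k^-1)%g; apply: ucover_inj; apply/funext => i /=.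
by rewrite xE -corner_translate mulgVK yE xy.
Qed.

Lemma frac_orbit_of x y : orbit_of x = orbit_of y -> frac x = frac y.
Proof. by move=> /orbit_ofP[g ->]; rewrite frac_translate. Qed.

(* The coordinates frac x v live on the circle: frac x v itself jumps from 1 to
   0, but its images under functions that agree at both ends are continuous. *)
Lemma frac_continuous (Q : R -> R) v : continuous Q -> Q 0 = 0 -> Q 1 = 0 ->
  continuous (fun x => Q (frac x v)).
Proof.
move=> Qc Q0 Q1 x; have [g [th tC xE]] := frac_spec x.
(* In the star of [g] one of these two coordinates is [frac y v] and the other is 0 or 1, where [Q]
   vanishes. *)
pose f (y : ucover) := Q (ucoord y (g, v)) + Q (ucoord y ((g * letter (v, false))%g, v)).
have fE y : in_star g (ucoord y) -> f y = Q (frac y v).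
  have [k [yh yC yE]] := frac_spec y; rewrite yE => ys.
  rewrite /f yE; have /= [[-> ->]|[-> ->]] := in_star_coord v yC yh ys.
    by rewrite Q1 addr0.
  by rewrite Q0 add0r.
have fc : f y @[y --> x] --> f x.
  have Qi i : continuous (fun y : ucover => Q (ucoord y i)).
    by move=> y; apply: (continuous_comp (@ucoord_continuous R D i y) (Qc _)).
  exact: (cvgD (Qi (g, v) x) (Qi ((g * letter (v, false))%g, v) x)).
have sx := in_star_nbhs th xE.
rewrite /continuous_at -(fE x) ?xE; last exact: in_star_corner.
apply: cvg_trans fc; apply: (@near_eq_cvg _ _ _ (nbhs_filter x)).
by apply: (@filterS _ _ (nbhs_filter x) _ _ _ sx) => y ys; rewrite fE.
Qed.

(** Points are separated by continuous functions of [r = frac x v] vanishing at 0 and 1: [r (1 - r)]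
    determines [r] up to exchange with [1 - r], and [r (1 - r) (1 - 2 r)] decides between the
    two. *)
Lemma salvetti_hausdorff : hausdorff_space salvetti.
Proof.
have sep (Q : R -> R) v (p q : salvetti) : continuous Q -> Q 0 = 0 -> Q 1 = 0 ->
    cluster (nbhs p) q -> Q (frac (repr p) v) = Q (frac (repr q) v).
  move=> Qc Q0 Q1 pq.
  pose F (p : salvetti) := Q (frac (repr p) v).
  have Fc : continuous F.
    apply/quotient_continuous; rewrite (_ : _ \o _ = fun x => Q (frac x v)).
      exact: frac_continuous.
    apply/funext => x; rewrite /F /=; congr (Q (_ v)); apply: frac_orbit_of.
    exact: (reprK (orbit_of x)).
  apply: (@norm_hausdorff R R (F p) (F q)) => B C pB qC.
  have [x [xB xC]] := pq _ _ (Fc p B pB) (Fc q C qC).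
  by exists (F x).
move=> p q pq; rewrite -[p]reprK -[q]reprK; apply: orbit_of_frac.
apply/funext => v.
have [_ [/(_ v)/andP[p0 p1] _ _]] := frac_spec (repr p).
have [_ [/(_ v)/andP[q0 q1] _ _]] := frac_spec (repr q).
have idc : continuous (fun r : R => r) by move=> r; apply: cvg_id.
have c1 : continuous (fun r : R => r * (1 - r)).
  by move=> r; apply: cvgM; [|apply: cvgB; [exact: cvg_cst|]]; exact: cvg_id.
have c2 : continuous (fun r : R => r * (1 - r) * (1 - 2 * r)).
  move=> r; apply: cvgM; first exact: c1.
  by apply: cvgB; [exact: cvg_cst|apply: cvgM; [exact: cvg_cst|exact: cvg_id]].
have c10 : 1 * (1 - 1) = 0 :> R by rewrite subrr mulr0.
have c20 : 0 * (1 - 0) * (1 - 2 * 0) = 0 :> R by rewrite !mul0r.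
have c21 : 1 * (1 - 1) * (1 - 2 * 1) = 0 :> R by rewrite subrr mulr0 mul0r.
have e1 := sep _ v p q c1 (mul0r _) c10 pq.
have e2 := sep _ v p q c2 c20 c21 pq.
move: e1 e2; set x := frac _ v in p0 p1 *; set y := frac _ v in q0 q1 *.
move=> e1 e2; have /eqP : (x - y) * (1 - x - y) = 0 by move: e1; lra.
rewrite mulf_eq0 => /orP[/eqP|/eqP xy]; first lra.
have [y0|y0] := eqVneq y 0; first lra.
have yy : y * (1 - y) != 0 by rewrite mulf_neq0 // gt_eqF // subr_gt0.
move: e2; rewrite e1 => /(mulfI yy); lra.
Qed.

Definition is_clique (s : {set D}) : bool :=
  [forall u in s, forall v in s, (u != v) ==> edge u v].

(** Cliques index the cells; the empty one gives the vertex. *)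
Definition clique := {s : {set D} | is_clique s}.
HB.instance Definition _ := Finite.on clique.

Lemma cliqueP (s : clique) u v : u \in val s -> v \in val s -> u != v -> edge u v.
Proof.
move=> us vs; have /forall_inP/(_ _ us)/forall_inP/(_ _ vs)/implyP := valP s; exact.
Qed.

(** Extends the characteristic maps continuously from the cube to all row vectors. *)
Definition clamp (r : R) : R := Num.max 0 (Num.min 1 r).

Definition cell_coord (s : clique) (z : 'rV[R]_(#|val s|)) v : R :=
  if [pick j | enum_val j == v] is Some j then clamp (z ord0 j) else 0.

Lemma clamp01 r : 0 <= clamp r <= 1.
Proof. by rewrite le_max lexx /= ge_max ler01 ge_min lexx. Qed.

Lemma clamp_id r : 0 <= r <= 1 -> clamp r = r.
Proof. by case/andP=> r0 r1; rewrite /clamp min_r // max_r. Qed.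

Lemma cell_coord_in s z j : @cell_coord s z (enum_val j) = clamp (z ord0 j).
Proof.
rewrite /cell_coord; case: pickP => [k /eqP /enum_val_inj -> //|/(_ j)].
by rewrite eqxx.
Qed.

Lemma cell_coord_notin (s : clique) z v : v \notin val s -> @cell_coord s z v = 0.
Proof.
move=> vs; rewrite /cell_coord; case: pickP => // j /eqP jv.
by rewrite -jv (enum_valP j) in vs.
Qed.

Lemma enum_val_ex (s : clique) v : v \in val s -> exists j : 'I_(#|val s|), enum_val j = v.
Proof. by move=> vs; exists (enum_rank_in vs v); rewrite enum_rankK_in. Qed.

Lemma cell_unit s z : in_unit (@cell_coord s z).
Proof.
move=> v; rewrite /cell_coord; case: pickP => [j _|_]; first exact: clamp01.
by rewrite lexx ler01.
Qed.

Lemma cell_clique s z : clique_supp (@cell_coord s z).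
Proof.
move=> u v uv u0 v0; apply: (cliqueP (s := s)) => //.
  by apply: contraNT u0 => /cell_coord_notin ->.
by apply: contraNT v0 => /cell_coord_notin ->.
Qed.

Lemma cell_subproof s z : is_point (corner_point (1%g : A) (@cell_coord s z)).
Proof.
by exists 1%g, xpredT, (@cell_coord s z); split; [exact: cell_unit|exact: cell_clique|].
Qed.

Definition cell_lift s z : ucover := UCover (@cell_subproof s z).
Definition cell s z : salvetti := orbit_of (@cell_lift s z).

Lemma cell_continuous s : continuous (@cell s).
Proof.
move=> z; apply: continuous_comp; last exact: orbit_of_continuous.
move: z; apply: continuous_to_ucover => -[a v] /=.
rewrite (_ : (fun x => _) = fun x =>
  if inlk v (a^-1 * 1) then @cell_coord s x v else (beyond v (a^-1 * 1))%:R); last first.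
  by apply/funext => x; rewrite corner_pointE.
case: (inlk _ _); last exact: cst_continuous.
rewrite /cell_coord; case: pickP => [j _|_]; last exact: cst_continuous.
move=> z; have h := @coord_continuous R 1 #|val s| ord0 j z.
have cst (r : R) : {for z, continuous (fun _ : 'rV[R]_(#|val s|) => r)}.
  exact: cst_continuous.
exact: (@continuous_max R _ _ _ z (cst 0) (@continuous_min R _ _ _ z (cst 1) h)).
Qed.

Definition supp t : {set D} := [set v | t v != 0].

Lemma cell_open s z : @open_cube R _ z ->
  [/\ in_halfopen (@cell_coord s z), supp (cell_coord z) = val s &
      frac (cell_lift z) = cell_coord z].
Proof.
move=> zo; have zj (j : 'I_(#|val s|)) : 0 < @cell_coord s z (enum_val j) < 1.
  have /andP[z0 z1] := zo j; rewrite cell_coord_in clamp_id ?z0 //.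
  by rewrite !ltW.
have th : in_halfopen (cell_coord z).
  move=> v; case: (boolP (v \in val s)) => [/(@enum_val_ex s)[j <-]|/cell_coord_notin ->].
    by have /andP[/ltW -> ->] := zj j.
  by rewrite lexx ltr01.
split=> //; last exact: (fracE (g := 1%g)).
apply/setP => v; rewrite inE.
case: (boolP (v \in val s)) => [/(@enum_val_ex s)[j <-]|/cell_coord_notin ->].
  by have /andP[/gt_eqF -> _] := zj j.
by rewrite eqxx.
Qed.

Lemma supp_clique t : clique_supp t -> is_clique (supp t).
Proof.
move=> tC; apply/forall_inP => u; rewrite inE => u0.
by apply/forall_inP => v; rewrite inE => v0; apply/implyP => uv; apply: tC.
Qed.

Definition supp_face t (tC : clique_supp t) : clique :=
  exist (fun s : {set D} => is_clique s) (supp t) (supp_clique tC).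

Lemma cell_surj (x : ucover) (s : clique) : val s = supp (frac x) ->
  exists2 z, @open_cube R #|val s| z & cell z = orbit_of x.
Proof.
have [g [fh fC xE]] := frac_spec x => sE.
pose z : 'rV[R]_(#|val s|) := \row_j frac x (enum_val j).
have zo : open_cube z.
  move=> j; rewrite mxE; have /andP[f0 f1] := fh (enum_val j).
  rewrite f1 andbT lt_neqAle f0 andbT eq_sym.
  by have := enum_valP j; rewrite {2}sE inE.
exists z => //; apply: orbit_of_frac; have [_ _ ->] := cell_open zo.
apply/funext => v; case: (boolP (v \in val s)) => [/(@enum_val_ex s)[j <-]|vs].
  rewrite cell_coord_in mxE clamp_id //.
  by have /andP[-> /ltW ->] := fh (enum_val j).
rewrite cell_coord_notin //; move: vs; rewrite sE inE negbK => /eqP ->.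
by [].
Qed.

Lemma corner_reduce t : in_unit t -> clique_supp t -> exists g,
  corner_point 1%g t = corner_point (g : A) (fun v => if t v == 1 then 0 else t v).
Proof.
(* The corner is generalized because each flip of a coordinate equal to 1 moves it. *)
move: 1%g => g; have [n] := ubnP #|[pred v | t v == 1]|.
elim: n => // n IH in g t *; rewrite ltnS => tn t01 tC.
have [v tv|t1] := pickP [pred v | t v == 1]; last first.
  by exists g; apply: eq_point => // v; have := t1 v; rewrite /= => ->.
have {}tv : t v = 1 by apply/eqP.
have tv0 : t v != 0 by rewrite tv oner_eq0.
have := point_flip g (fun=> true) tC tv0; rewrite /= => e.
have [|||h hE] := IH (g * letter (v, true))%g [eta t with v |-> 1 - t v].
- apply: leq_trans tn; apply: proper_card; apply/properP; split.
    apply/fintype.subsetP => u; rewrite !inE /=; case: (eqVneq u v) => [->|//] _.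
    by rewrite tv.
  by exists v; rewrite !inE /= ?tv // eqxx subrr eq_sym oner_eq0.
- exact: in_unit_flip.
- exact: clique_flip.
exists h; rewrite /corner_point in hE *; rewrite e.
transitivity (cube_point (g * letter (v, true))%g (fun=> true) [eta t with v |-> 1 - t v]).
  by apply: eq_point => // u /=; case: (eqVneq u v) => // _; rewrite tv subrr eqxx.
rewrite hE; apply: eq_point => // u /=; case: (eqVneq u v) => [->|//].
by rewrite tv subrr eqxx eq_sym oner_eq0.
Qed.

Lemma salvetti_CW : finite_CW R salvetti.
Proof.
split; first exact: salvetti_hausdorff.
exists clique, (fun s : clique => #|val s|), cell; split.
- by move=> s; apply: continuous_subspaceT; apply: cell_continuous.
- move=> s z z' /set_mem zo /set_mem zo' /frac_orbit_of.
  have [_ _ ->] := cell_open zo; have [_ _ ->] := cell_open zo' => zz.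
  apply/rowP => j; have := congr1 (fun f => f (enum_val j)) zz.
  rewrite !cell_coord_in !clamp_id //; first by have /andP[/ltW -> /ltW ->] := zo' j.
  by have /andP[/ltW -> /ltW ->] := zo j.
- move=> p; have [x <-] := orbit_of_surj p.
  have [g [fh fC xE]] := frac_spec x.
  exists (supp_face fC); split.
    by have [z zo zx] := @cell_surj x (supp_face fC) erefl; exists z.
  move=> s [z zo /frac_orbit_of]; have [_ zs ->] := cell_open zo => zx.
  by apply: val_inj; rewrite -zs zx.
(* A boundary point has a coordinate 0 or 1. Replacing the ones by zeros, as in [corner_reduce],
   leaves a point whose support is a strictly smaller clique. *)
- move=> s z zc nzo.
  have [g e] := corner_reduce (@cell_unit s z) (@cell_clique s z).
  set t := cell_coord z in e; set t' := fun v => _ in e.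
  have t'h : in_halfopen t'.
    move=> v; rewrite /t'; have /andP[t0 t1] := cell_unit z v.
    case: eqP => [_|/eqP tv]; first by rewrite lexx ltr01.
    by rewrite t0 lt_neqAle tv t1.
  have xt : frac (cell_lift z) = t' := fracE (x := cell_lift z) t'h e.
  have [_ [_ fC _]] := frac_spec (cell_lift z); rewrite xt in fC.
  pose s' := supp_face fC.
  have s'E : val s' = supp (frac (cell_lift z)) by rewrite xt.
  exists s'; last by have [z' zo' z'E] := cell_surj s'E; exists z'.
  apply: proper_card; apply/properP; split.
    apply/fintype.subsetP => v; rewrite inE; apply: contraNT => vs.
    by rewrite /t' /t cell_coord_notin // if_same.
  have [j nj] : exists j, ~~ (0 < z ord0 j < 1).
    by apply: contrapT => h; apply: nzo => j; apply: contrapT => /negP nj; apply: h; exists j.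
  exists (enum_val j); first exact: enum_valP.
  rewrite inE negbK /t' /t cell_coord_in clamp_id ?zc //.
  move: nj (zc j) => + /andP[z0 z1]; rewrite !lt_neqAle z0 z1 !andbT negb_and !negbK.
  by case: (eqVneq (z ord0 j) 1) => //= _; rewrite orbF eq_sym.
Qed.

Lemma type_F_raag : type_F R A.
Proof. by exists salvetti; [exact: salvetti_CW|exact: classifying_salvetti]. Qed.

End SalvettiCW.

(** * Automorphisms *)

Section Bundles.
Variables (G H : groupType) (f : G -> H) (fM : {morph f : x y / x * y}).

Definition hom_of of {morph f : x y / x * y} := f.
HB.instance Definition _ := isMultiplicative.Build G H (hom_of fM) fM.

Lemma giso_of_bij : injective f -> (forall y, exists x, f x = y) ->
  exists F : giso G H, F =1 f.
Proof.
move=> finj fsurj; pose f' y := proj1_sig (cid (fsurj y)).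
have f'K : cancel f' f by move=> y; apply: (proj2_sig (cid (fsurj y))).
have fK : cancel f f' by move=> x; apply: finj; rewrite f'K.
by exists (Giso fM fK f'K).
Qed.

End Bundles.

Lemma type_F_giso (R : realType) (G H : groupType) :
  giso G H -> type_F R H -> type_F R G.
Proof.
move=> f [X XCW [E [act [p [Ec [[a1 aM ac acov] [ps po pq]]]]]]].
exists X => //; exists E, (fun g => act (f g)), p; split=> //; split; split=> //.
- by move=> e; rewrite (morph1 (gisoM f)).
- by move=> g h e; rewrite gisoM.
- move=> e; have [U eU UP] := acov e; exists U => // g g1; apply: UP => fg.
  by apply: g1; rewrite -(gisoK f g) fg -(morph1 (gisoM f)) gisoK.
- move=> e e'; rewrite po; split=> -[g ge]; last by exists (f g).
  by exists (giso_inv f g); rewrite gisoVK.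
Qed.

(** * The cone over a graph, and type F *)

Section Cone.
Variable D : sgraph.
Local Notation A := (raag D).
Local Notation J := (graph_join D (complete_graph 1)).

Let apex : J := inr ord0.
Local Notation gapex := (raag_gen apex).

Let commute_apex x m : commute x (zexpg gapex m).
Proof.
apply: zexpg_commute; move: x; apply: pres_ind_r => [|x l xc].
  exact/commute_sym/commute1.
apply/commute_sym/commuteM; first exact: commute_sym.
case: l => -[v|i] b.
  exact: (letterC (l := (apex, true)) (m := (inl v : J, b)) isT).
have -> : i = ord0 by apply: ord_inj; case: i => -[].
case: b; first exact: commute_refl.
rewrite -[(_, false)]/(linv (apex, true)) letterV.
exact/commuteV/commute_refl.
Qed.

Let inclC (u v : D) : edge u v ->
  commute (raag_gen (inl u : J)) (raag_gen (inl v : J)).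
Proof. by move=> uv; apply: raag_gen_commute. Qed.

Let incl : A -> raag J := raag_lift (fun v => raag_gen (inl v : J)).
Let inclM : {morph incl : x y / x * y}. Proof. exact: raag_liftM inclC. Qed.
Let incl_gen v : incl (raag_gen v) = raag_gen (inl v : J).
Proof. exact: raag_lift_gen inclC v. Qed.

Let cone_fun (x : A * Zg) : raag J := incl x.1 * zexpg gapex x.2.

Let cone_funM : {morph cone_fun : x y / x * y}.
Proof.
move=> x y; rewrite /cone_fun /= inclM (zexpgD gapex).
by rewrite -!mulgA; congr (_ * _); rewrite !mulgA (commute_apex (incl y.1)).
Qed.

Let cone_inv_gen (v : J) : A * Zg :=
  match v with inl u => (raag_gen u, 1) | inr _ => (1, 1%R : Zg) end.

Let cone_invC (u v : J) : edge u v -> commute (cone_inv_gen u) (cone_inv_gen v).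
Proof.
case: u v => [u|i] [v|j] /= uv; congr (_, _) => /=.
all: rewrite ?mul1g ?mulg1 //.
exact: raag_gen_commute.
Qed.

Let cone_inv : raag J -> A * Zg := raag_lift cone_inv_gen.
Let cone_invM : {morph cone_inv : x y / x * y}.
Proof. exact: raag_liftM cone_invC. Qed.
Let cone_inv_genE v : cone_inv (raag_gen v) = cone_inv_gen v.
Proof. exact: raag_lift_gen cone_invC v. Qed.

Let cone_funK : cancel cone_fun cone_inv.
Proof.
case=> g m; rewrite /cone_fun cone_invM /=.
have -> : cone_inv (incl g) = (g, 1).
  move: g; apply: (@pres_hom_ext _ (@raag_rels D) (A * Zg)%type
    (fun g => cone_inv (incl g)) (fun g => (g, 1))).
  - by move=> a b /=; rewrite inclM cone_invM.
  - by move=> a b; congr (_, _); rewrite mulg1.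
  - by move=> v /=; rewrite -!/(raag_gen _) incl_gen cone_inv_genE.
have -> : cone_inv (zexpg gapex m) = zexpg (cone_inv gapex) m.
  exact: (hom_zexpg (hom_of cone_invM)).
rewrite cone_inv_genE zexpg_pair /= zexpg_one zexpg_Zg.
by congr (_, _); rewrite /= ?mulg1 ?mul1g.
Qed.

Let cone_invK : cancel cone_inv cone_fun.
Proof.
move=> x; move: x; apply: (@pres_hom_ext _ (@raag_rels J) _
  (fun x => cone_fun (cone_inv x)) id) => //.
  by move=> a b /=; rewrite cone_invM cone_funM.
move=> [v|i]; rewrite -/(raag_gen _) cone_inv_genE /cone_fun /=.
  by rewrite incl_gen mulg1.
have -> : i = ord0 by apply: ord_inj; case: i => -[].
by rewrite (morph1 inclM) mul1g expg1.
Qed.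

Definition cone_iso : giso (A * Zg)%type (raag J) := Giso cone_funM cone_funK cone_invK.

Lemma type_F_bb (R : realType) : type_F R (bb (joinK2 D)).
Proof.
apply: type_F_giso (type_F_raag R J).
exact: (giso_comp cone_iso (giso_sym (iota_iso D))).
Qed.

End Cone.

(** * Automorphisms of the product with Z *)

Section AutProduct.
Variable D : sgraph.
Local Notation A := (raag D).
Local Notation H := (bb (joinK2 D)).
Implicit Types (n : ZgX D) (a : Aut A) (k : Z2g).

Lemma sgnZ2_sq k : (sgnZ2 k * sgnZ2 k = 1)%R.
Proof. by rewrite /sgnZ2 -expr2 -exprM mulnC exprM sqrrN !expr1n. Qed.

Lemma sgnZ2_inj : injective sgnZ2.
Proof.
by case=> -[|[|k]] kP [[|[|l]] lP] //; rewrite /sgnZ2 /= ?expr0 ?expr1 //= => _;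
  apply: val_inj.
Qed.

Let ZgM (x y : Zg) : x * y = ((x : int) + (y : int))%R.
Proof. by []. Qed.

Section AutProd.
Variables (n : ZgX D) (a : Aut A) (k : Z2g).

(** [n] is evaluated after [a] because [(n, q)] is the product of [(n, 1)] and [(1, q)], in which
    [q] acts first. *)
Let f (x : A * Zg) : A * Zg :=
  (a x.1, ((raag_char n (a x.1) : int) + sgnZ2 k * (x.2 : int))%R).
Let f' (x : A * Zg) : A * Zg :=
  (giso_inv a x.1, (sgnZ2 k * ((x.2 : int) - (raag_char n x.1 : int)))%R).

Let fM : {morph f : x y / x * y}.
Proof.
move=> [g i] [h j]; rewrite /f /= gisoM; congr (_, _).
by rewrite raag_charM !ZgM /= mulrDr addrACA.
Qed.

Let fK : cancel f f'.
Proof.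
case=> g i; rewrite /f /f' /= gisoK; congr (_, _).
by rewrite addrAC subrr add0r mulrA sgnZ2_sq mul1r.
Qed.

Let fVK : cancel f' f.
Proof.
case=> g i; rewrite /f /f' /= gisoVK; congr (_, _).
by rewrite mulrA sgnZ2_sq mul1r addrC subrK.
Qed.

Definition aut_prod : Aut (A * Zg)%type := Giso fM fK fVK.

End AutProd.

Lemma aut_prodE n a k g i : aut_prod n a k (g, i) =
  (a g, ((raag_char n (a g) : int) + sgnZ2 k * (i : int))%R).
Proof. by []. Qed.

Lemma raag_char1 (g : A) : raag_char (1 : ZgX D) g = 1.
Proof.
move: g; apply: (@pres_hom_ext _ (@raag_rels D) Zg _ (fun=> 1)).
- exact: raag_charM.
- by move=> x y; rewrite mulg1.
- by move=> v; rewrite -/(raag_gen _) raag_char_gen ffunE.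
Qed.

Lemma raag_char_mul n n' (g : A) : raag_char (n * n') g = raag_char n g * raag_char n' g.
Proof.
move: g; apply: (@pres_hom_ext _ (@raag_rels D) Zg _
  (fun h => raag_char n h * raag_char n' h)).
- exact: raag_charM.
- by move=> x y; rewrite !raag_charM; apply: addrACA.
- by move=> w; rewrite -/(raag_gen w) !raag_char_gen ffunE.
Qed.

Lemma raag_char_inj n n' : (forall g : A, raag_char n g = raag_char n' g) -> n = n'.
Proof. by move=> nn; apply/ffunP => v; rewrite -!raag_char_gen nn. Qed.

Definition aut_bb (p : semidirect (aut_act D)) : Aut H :=
  giso_comp (iota_iso D) (giso_comp (aut_prod p.1 p.2.1 p.2.2) (giso_sym (iota_iso D))).

Lemma aut_bbE p x : aut_bb p (bb_iota x) = bb_iota (aut_prod p.1 p.2.1 p.2.2 x).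
Proof. by rewrite /= iotaK. Qed.

Lemma bb_iota_surj (y : H) : exists x, bb_iota x = y.
Proof. by exists (iota_inv y); apply: iotaVK. Qed.

Lemma aut_bbM : {morph aut_bb : p q / p * q}.
Proof.
move=> [n [a k]] [n' [a' k']]; apply: gisoP => y.
have [[g i] <-] := bb_iota_surj y.
rewrite autM_E !aut_bbE !aut_prodE; congr (bb_iota (_, _)).
change (raag_char (n * aut_act_fun (a, k) n')%g ((a * a')%g g) + sgnZ2 (k * k')%g * (i : int)
  = raag_char n (a (a' g)) + sgnZ2 k * (raag_char n' (a' g) + sgnZ2 k' * (i : int)))%R.
by rewrite raag_char_mul aut_act_char ZgM sgnZ2M /= gisoK mulrDr addrA mulrA.
Qed.

Lemma aut_bb_emb a : aut_bb (sd_inr (aut_act D) (a, 1)) = aut_emb a.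
Proof.
apply: gisoP => y; have [[g i] <-] := bb_iota_surj y.
rewrite aut_bbE aut_prodE aut_embE; congr (bb_iota (_, _)).
by rewrite raag_char1 /= /sgnZ2 expr0 mul1r add0r.
Qed.

Lemma aut_bb_inj : injective aut_bb.
Proof.
move=> [n [a k]] [n' [a' k']] e.
have {}e x : aut_prod n a k x = aut_prod n' a' k' x.
  by apply: (can_inj (@iotaK D)); rewrite -!(aut_bbE (_, (_, _))) e.
have aa : a = a'.
  by apply: gisoP => g; have := congr1 fst (e (g, 1)).
subst a'; have nn : n = n'.
  apply: raag_char_inj => g; have := congr1 snd (e (a^-1 g, 0%R)).
  by rewrite /= !mulr0 !addr0 gisoVK.
subst n'; congr (_, (_, _)); apply: sgnZ2_inj.
by have := congr1 snd (e (1, 1%R)); rewrite /= !mulr1 => /addrI.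
Qed.

Lemma zmul_hom (s : Zg -> Zg) : {morph s : x y / x * y} ->
  forall m : int, s m = ((s 1%R : int) * m)%R.
Proof.
move=> sM m; have -> : s m = zexpg (s 1%R) m.
  rewrite -{1}(zexpg_Zg m).
  exact: (hom_zexpg (hom_of sM : {multiplicative Zg -> Zg})).
move: (s 1%R) => r {s sM}.
elim/int_ind: m => [|n IH|n IH]; first by rewrite mulr0.
- by rewrite -addn1 PoszD zexpgS IH mulrDr mulr1.
- rewrite -addn1 PoszD opprD; apply: (@mulIg Zg r).
  by rewrite -zexpgS subrK IH ZgM mulrBr mulr1 subrK.
Qed.

Lemma sgnZ2_surj (x y : int) : (x * y = 1)%R -> exists k, sgnZ2 k = x.
Proof.
move=> /(congr1 absz)/eqP; rewrite abszM muln_eq1 => /andP[x1 _].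
case: x x1 => [[|[|n]]|[|n]] //= _; first by exists (0%R : 'Z_2).
by exists (1%R : 'Z_2).
Qed.

Section Surjectivity.
Hypothesis Ac : centerless A.

(** [(1, i)] is central and [psi] is onto, so the first component of its image commutes with all of
    [A]. *)
Lemma aut_prod_center (psi : Aut (A * Zg)%type) (i : Zg) : (psi (1, i)).1 = 1.
Proof.
apply: Ac => x; have := gisoVK psi (x, 1); set y := giso_inv psi (x, 1) => ey.
have : psi (1, i) * psi y = psi y * psi (1, i).
  rewrite -!gisoM; congr (psi (_, _)); first by rewrite mul1g mulg1.
  exact: Algebra.commuteT.
by rewrite ey => /(congr1 fst).
Qed.

Lemma aut_prod_split (psi : Aut (A * Zg)%type) g i :
  psi (g, i) = ((psi (g, 1)).1, (psi (g, 1)).2 * (psi (1, i)).2).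
Proof.
have -> : (g, i) = (g, 1) * (1, i) :> A * Zg by congr (_, _); rewrite ?mulg1 ?mul1g.
rewrite gisoM [LHS]surjective_pairing /= aut_prod_center mulg1.
by congr (_, _ * (psi (_, _)).2); rewrite ?mulg1 ?mul1g.
Qed.

Let aut_fst_fun (psi : Aut (A * Zg)%type) (g : A) : A := (psi (g, 1)).1.

Let aut_fstM psi : {morph aut_fst_fun psi : x y / x * y}.
Proof.
move=> x y; rewrite /aut_fst_fun.
by rewrite -[in LHS](mulg1 (1 : Zg)) -[(x * y, _)]/((x, 1) * (y, 1)) gisoM.
Qed.

Let aut_fstK (psi : Aut (A * Zg)%type) : cancel (aut_fst_fun psi) (aut_fst_fun (giso_sym psi)).
Proof.
move=> g; rewrite /aut_fst_fun.
have := gisoK psi (g, 1); rewrite [psi _]surjective_pairing.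
by rewrite -[giso_inv psi _]/(giso_sym psi _) aut_prod_split => /(congr1 fst).
Qed.

Let aut_fstVK (psi : Aut (A * Zg)%type) : cancel (aut_fst_fun (giso_sym psi)) (aut_fst_fun psi).
Proof. exact: (aut_fstK (giso_sym psi)). Qed.

Definition aut_fst psi : Aut A := Giso (@aut_fstM psi) (@aut_fstK psi) (@aut_fstVK psi).

Lemma aut_prod_surj (psi : Aut (A * Zg)%type) : exists n a k, aut_prod n a k = psi.
Proof.
pose s (phi : Aut (A * Zg)%type) (i : Zg) : Zg := (phi (1, i)).2.
have sM phi : {morph s phi : x y / x * y}.
  move=> x y; rewrite /s -{1}(mulg1 (1 : A)).
  by rewrite -[(_, x * y)]/((1, x) * (1, y)) gisoM.
(* The restrictions of [psi] and its inverse to Z are multiplications by integers; their product is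
   1, so each is a sign. *)
have sK : s (giso_sym psi) (s psi 1%R) = 1%R.
  have := gisoK psi (1, 1%R : Zg); rewrite [psi _]surjective_pairing aut_prod_center.
  by move=> /(congr1 snd).
have [k kE] : exists k, sgnZ2 k = s psi 1%R.
  by apply: (@sgnZ2_surj _ (s (giso_sym psi) 1%R)); rewrite mulrC -zmul_hom.
(* As [aut_prod] evaluates [n] after [a], the second component of [psi] is precomposed with the
   inverse of [a]. *)
pose a := aut_fst psi; pose n : ZgX D := [ffun v => (psi (a^-1 (raag_gen v), 1)).2].
exists n, a, k; apply: gisoP => -[g i].
rewrite aut_prodE aut_prod_split; congr (_, _).
have -> : raag_char n (a g) = (psi (g, 1)).2.
  rewrite -{2}(gisoK a g : a^-1 (a g) = g); move: (a g).
  apply: (@pres_hom_ext _ (@raag_rels D) Zg _ (fun h => (psi (a^-1 h, 1)).2)).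
  - exact: raag_charM.
  - move=> x y; rewrite gisoM -{1}(mulg1 (1 : Zg)).
    by rewrite -[(a^-1 x * a^-1 y, _)]/((a^-1 x, 1) * (a^-1 y, 1)) gisoM.
  - by move=> v; rewrite -/(raag_gen _) raag_char_gen ffunE.
by rewrite ZgM kE -zmul_hom.
Qed.

Lemma aut_bb_surj (phi : Aut H) : exists p, aut_bb p = phi.
Proof.
have [n [a [k e]]] := aut_prod_surj
  (giso_comp (giso_sym (iota_iso D)) (giso_comp phi (iota_iso D))).
exists (n, (a, k)); apply: gisoP => y; have [x <-] := bb_iota_surj y.
by rewrite aut_bbE -[aut_prod _ _ _]/(aut_prod n a k) e; apply: iotaVK.
Qed.

End Surjectivity.

End AutProduct.

(** * Outer automorphisms *)

Section OutProduct.
Variable D : sgraph.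
Local Notation A := (raag D).
Local Notation H := (bb (joinK2 D)).
Implicit Types (n : ZgX D) (a : Aut A) (k : Z2g).

Definition out_bb (p : semidirect (out_act D)) : Out H :=
  out_of (aut_bb (p.1, (repr p.2.1, p.2.2))).

Lemma aut_act_inn g n : aut_act_fun (Inn g, 1) n = n.
Proof.
have e : out_of (Inn g) = out_of 1 :> Out A by apply/out_ofP; exists g; rewrite mulg1.
by rewrite -out_act_funE e out_act_funE; apply: (gact1 (aut_act D)).
Qed.

Lemma aut_bb_inn g n a k : aut_bb (n, (Inn g * a, k)) = Inn (bb_iota (g, 1)) * aut_bb (n, (a, k)).
Proof.
rewrite -aut_emb_Inn -aut_bb_emb -aut_bbM; congr aut_bb.
rewrite -[RHS]/(1 * aut_act_fun (Inn g, 1) n, (Inn g * a, 1 * k)).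
by rewrite aut_act_inn !mul1g.
Qed.

Lemma out_bbE n a k : out_bb (n, (out_of a, k)) = out_of (aut_bb (n, (a, k))).
Proof.
rewrite /out_bb /=; have [g ->] := out_reprP a; apply/out_ofP.
by exists (bb_iota (g, 1)); rewrite aut_bb_inn.
Qed.

Lemma out_bbM : {morph out_bb : p q / p * q}.
Proof.
move=> [n [x k]] [n' [x' k']].
have [a <-] := out_of_surj x; have [a' <-] := out_of_surj x'.
change (out_bb (n * out_act_fun (out_of a, k) n', (out_of a * out_of a', k * k')) =
  out_bb (n, (out_of a, k)) * out_bb (n', (out_of a', k'))).
by rewrite -out_ofM out_act_funE !out_bbE -out_ofM -aut_bbM.
Qed.

(** The factor Z is central, so conjugation by [(g, i)] is the embedded inner automorphism of [g],
    which changes only the component [a], by [Inn g]. *)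
Lemma out_bb_inj : injective out_bb.
Proof.
move=> [n [x k]] [n' [x' k']].
have [a <-] := out_of_surj x; have [a' <-] := out_of_surj x'.
rewrite !out_bbE => /out_ofP[h]; have [[g i] <-] := bb_iota_surj h.
have -> : Inn (bb_iota (g, i)) = Inn (bb_iota (g, 1)).
  apply: gisoP => y; have [[g' j] <-] := bb_iota_surj y.
  rewrite /= -!(morphV (@iotaM D)) -!iotaM; congr (bb_iota (_, _)) => /=.
  by rewrite [i * _]Algebra.commuteT [1 * _]Algebra.commuteT !mulgK.
rewrite -aut_bb_inn => /aut_bb_inj[-> -> ->]; congr (_, (_, _)).
by apply/out_ofP; exists g.
Qed.

Lemma out_bb_surj : centerless A -> forall y, exists p, out_bb p = y.
Proof.
move=> Ac y; have [phi <-] := out_of_surj y.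
have [[n [a k]] <-] := aut_bb_surj Ac phi.
by exists (n, (out_of a, k)); rewrite out_bbE.
Qed.

Lemma out_bb_emb x : out_bb (sd_inr (out_act D) (x, 1)) = out_emb x.
Proof.
have [a <-] := out_of_surj x.
by rewrite out_bbE out_embE -aut_bb_emb.
Qed.

End OutProduct.

(** * Retractions, biconnectedness and the theorem *)

Lemma semidirect_retraction (Q K N G : groupType) (act : gaction (Q * K)%type N)
    (F : giso (semidirect act) G) : exists r : {multiplicative G -> Q},
  forall q, r (F (sd_inr act (q, 1))) = q.
Proof.
have rM : {morph (fun y => (giso_inv F y).2.1) : x y / x * y}.
  by move=> x y /=; rewrite giso_invM.
exists (hom_of rM) => q.
exact: (congr1 (fun p => p.2.1) (gisoK F (sd_inr act (q, 1)))).
Qed.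

Lemma connected_hub (G : sgraph) (h : G) :
  (forall x : G, x != h -> edge x h) -> connected_graph G.
Proof.
move=> eh; split; first by apply/card_gt0P; exists h.
have ch x : connect (@edge G) x h.
  by have [->|/eh/connect1//] := eqVneq x h; apply: connect0.
have sym : connect_sym (@edge G) by apply: fingraph.sym_connect_sym; apply: edge_sym.
by move=> x y; apply: connect_trans (ch x) _; rewrite sym ch.
Qed.

(** Both vertices of the complete graph are adjacent to all others, and deleting one vertex leaves
    at least one of them. *)
Lemma biconnected_joinK2 (D : sgraph) : (0 < #|D|)%N -> biconnected (joinK2 D).
Proof.
move=> D0; have hub (i : 'I_2) (x : joinK2 D) : x != inr i -> edge x (inr i : joinK2 D).
  by case: x => [v|j].
split; first by rewrite card_sum card_ord addn2 !ltnS.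
  exact: (connected_hub (hub ord0)).
move=> v; have [i vi] : exists i : 'I_2, (inr i : joinK2 D) != v.
  have [v0|v0] := eqVneq (inr ord0 : joinK2 D) v; last by exists ord0.
  by exists ord_max; rewrite -v0.
apply: (@connected_hub (graph_del v) (exist _ (inr i) vi)) => x xi.
exact: (hub i (val x)).
Qed.

(** The generator of a universal vertex would be central, and it is not 1 since [raag_chi] takes the
    value 1 in Z on it. *)
Lemma raag_no_universal (D : sgraph) : centerless (raag D) -> forall v : D, ~ universal v.
Proof.
move=> Dc v vu; suff /Dc v1 : forall x, commute (raag_gen v) x.
  by have := raag_chi_gen v; rewrite v1 (hom1 (@raag_chi D)).
apply: pres_ind_r => [|x l xc]; first exact: commute1.
apply: commuteM => //; have [lv|lv] := eqVneq l.1 v; last first.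
  by apply: (letterC (l := (v, true))); apply: vu.
case: l lv => u [] /= ->; first exact: commute_refl.
rewrite -[(v, false)]/(linv (v, true)) letterV.
exact/commuteV/commute_refl.
Qed.

Lemma group_retract_trivial (G H : groupType) : (forall x y : G, x = y) -> group_retract G H.
Proof.
move=> G1.
have sM : {morph (fun _ : G => 1 : H) : x y / x * y} by move=> x y; rewrite mulg1.
have rM : {morph (fun _ : H => 1 : G) : x y / x * y} by move=> x y; rewrite mulg1.
by exists (hom_of sM), (hom_of rM) => x; apply: G1.
Qed.

Lemma raag_empty (D : sgraph) : #|D| = 0%N -> forall a b : Aut (raag D), a = b.
Proof.
move=> D0; have v0 (v : D) : False by have := max_card (pred1 v); rewrite D0 card1.
have g1 (g : raag D) : g = 1 by elim/pres_ind: g => // v; case: (v0 v).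
by move=> a b; apply: gisoP => g; rewrite (g1 (a g)) (g1 (b g)).
Qed.

Theorem theorem15p13 (R : realType) :
  (forall D : sgraph, (0 < #|D|)%N -> (forall v : D, ~ universal v) ->
    [/\ exists Phi : giso (semidirect (aut_act D)) (Aut (bb (joinK2 D))),
          forall a : Aut (raag D), Phi (sd_inr (aut_act D) (a, 1)) = aut_emb a,
        exists Psi : giso (semidirect (out_act D)) (Out (bb (joinK2 D))),
          forall x : Out (raag D), Psi (sd_inr (out_act D) (x, 1)) = out_emb x,
        injective (@aut_emb D) /\ injective (@out_emb D),
        exists r : {multiplicative Aut (bb (joinK2 D)) -> Aut (raag D)},
          (forall a, exists b, r b = a) /\ (forall a, r (aut_emb a) = a) &
        exists r : {multiplicative Out (bb (joinK2 D)) -> Out (raag D)},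
          (forall x, exists y, r y = x) /\ (forall x, r (out_emb x) = x)]) /\
  (forall D : sgraph, centerless (raag D) ->
    exists G : sgraph, [/\ biconnected G, type_F R (bb G) &
      group_retract (Aut (raag D)) (Aut (bb G))]).
Proof.
have part1 (D : sgraph) : (forall v : D, ~ universal v) ->
    [/\ exists Phi : giso (semidirect (aut_act D)) (Aut (bb (joinK2 D))),
          forall a : Aut (raag D), Phi (sd_inr (aut_act D) (a, 1)) = aut_emb a,
        exists Psi : giso (semidirect (out_act D)) (Out (bb (joinK2 D))),
          forall x : Out (raag D), Psi (sd_inr (out_act D) (x, 1)) = out_emb x,
        exists r : {multiplicative Aut (bb (joinK2 D)) -> Aut (raag D)},
          forall a, r (aut_emb a) = a &
        exists r : {multiplicative Out (bb (joinK2 D)) -> Out (raag D)},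
          forall x, r (out_emb x) = x].
  move=> /raag_centerless Dc.
  have [Phi PhiE] := giso_of_bij (@aut_bbM D) (@aut_bb_inj D) (aut_bb_surj Dc).
  have [Psi PsiE] := giso_of_bij (@out_bbM D) (@out_bb_inj D) (out_bb_surj Dc).
  have Phi1 a : Phi (sd_inr (aut_act D) (a, 1)) = aut_emb a by rewrite PhiE aut_bb_emb.
  have Psi1 x : Psi (sd_inr (out_act D) (x, 1)) = out_emb x by rewrite PsiE out_bb_emb.
  split; [by exists Phi|by exists Psi| |].
    by have [r rE] := semidirect_retraction Phi; exists r => a; rewrite -Phi1; apply: rE.
  by have [r rE] := semidirect_retraction Psi; exists r => x; rewrite -Psi1; apply: rE.
split=> [D _ /part1[PhiP PsiP [r rK] [s sK]]|D Dc].
  split=> //.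
  - split; first exact: can_inj rK.
    exact: can_inj sK.
  - by exists r; split=> // a; exists (aut_emb a).
  - by exists s; split=> // x; exists (out_emb x).
(* For the empty graph, whose group is trivial, take K_3 instead of K_2. *)
have [D0|D0] := posnP #|D|.
  exists (joinK2 (complete_graph 1)); split; first by apply: biconnected_joinK2; rewrite card_ord.
    exact: type_F_bb.
  exact/group_retract_trivial/raag_empty.
exists (joinK2 D); split; [exact: biconnected_joinK2|exact: type_F_bb|].
have [_ _ [r rK] _] := part1 D (raag_no_universal Dc).
by exists (@aut_emb D), r.
Qed.
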